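(* Let $D$ be a connected (oriented) alternating virtual link diagram of genus $g$. Let $\xi$ be the checkerboard coloring of $D$ for which every classical crossing of $D$ has incidence number $\eta=-1$, let $\xi^*$ be the dual coloring, and let $\sigma_{\xi}=\sigma_\xi(D)$, $\sigma_{\xi^*}=\sigma_{\xi^*}(D)$ be the corresponding signatures. Then the Khovanov homology of $D$ is supported in the $g+2$ lines $$j=2i-\sigma_{\xi^*}+1,\quad j=2i-\sigma_{\xi^*}-1,\quad \ldots,\quad j=2i-\sigma_{\xi}-1,$$ i.e. if $Kh^{i,j}(D)\neq 0$ then $j-2i\in\{-\sigma_{\xi^*}+1,\,-\sigma_{\xi^*}-1,\,-\sigma_{\xi^*}-3,\ldots,-\sigma_{\xi}-1\}$ (consecutive values differ by $2$).
   Context: Diagrams and surfaces. A virtual link diagram $D$ is a generic collection of immersed closed curves in the plane whose double points are marked as classical (with over/under information) or virtual. It is alternating if over- and under-crossings alternate along each component (virtual crossings are ignored). Let $S_D$ be the compact oriented surface obtained from disks around the classical crossings by attaching bands along the arcs of $D$ (at virtual crossings the bands pass each other disjointly; a component without classical crossings gives an annulus). It carries a diagram $\widetilde D$ corresponding to $D$, without virtual crossings, and $S_D$ is a regular neighborhood of $\widetilde D$. $D$ is connected if $S_D$ is. The genus (supporting genus) of a connected $D$ is the genus of $S_D$, i.e. of the closed oriented surface $\Sigma_D$ obtained by capping the boundary circles of $S_D$ with disks. Colorings and signatures. A checkerboard coloring $\xi$ of $D$ is a black/white coloring of the regions of $\Sigma_D\smallsetminus\widetilde D$ such that regions sharing an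 edge have different colors; the dual coloring $\xi^*$ interchanges black and white. Every alternating virtual link diagram admits a checkerboard coloring. At a classical crossing $c$ the incidence number is $\eta(c)=+1$ if the two local regions swept out when the over-strand is rotated counterclockwise (with respect to the orientation of the surface) to the under-strand are black, and $\eta(c)=-1$ if they are white. A connected checkerboard colored diagram is alternating if and only if all its crossings have the same incidence number. Let $\varepsilon(c)=\pm1$ be the writhe (sign) of $c$; $c$ is of type II if $\varepsilon(c)\eta(c)=1$ and of type I otherwise. Let $X_0,\dots,X_m$ be the white regions of $\Sigma_D\smallsetminus\widetilde D$. For $i\ne j$ let $g_{ij}=-\sum\eta(c)$, the sum over crossings adjacent to both $X_i$ and $X_j$, and $g_{ii}=-\sum_{k\neq i}g_{ik}$. The Goeritz matrix is $G_\xi(D)=(g_{ij})_{1\le i,j\le m}$, the correction term is $\mu_\xi(D)=\sum_{c\text{ of type II}}\eta(c)$, and the signature is $\sigma_\xi(D)=\operatorname{sig}(G_\xi(D))-\mu_\xi(D)$ (here $\operatorname{sig}$ is the signature of a symmetric matrix). Khovanov homology of a checkerboard colorable diagram (coefficients $\mathbb Q$). Let $D$ have classical crossings $c_1,\dots,c_n$, of which $n_+$ are positive and $n_-$ negative. The $0$-smoothing of a crossing merges the two local regions swept out when the over-strand is rotated counterclockwise to the under-strand (so it is the oriented smoothing at a positive crossing); the $1$-smoothing is the other one. A state $\alpha\in\{0,1\}^n$ prescribes a smoothing at each classical crossing; it has $k_\alpha$ cycles (closed curves, virtual crossings ignored), and $r_\alpha$ is the number of $1$'s in $\alpha$. Let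 $V=\mathbb Q\mathbf 1\oplus\mathbb QX$ with $\deg\mathbf 1=1$, $\deg X=-1$, and $W\{\ell\}_m=W_{m-\ell}$. Put $\mathcal C^{i,*}(D)=\bigoplus_{r_\alpha=i+n_-}V^{\otimes k_\alpha}\{r_\alpha+n_+-2n_-\}$, where $i$ is the homological and $j$ the quantum degree. The differential is the sum, over all edges $\alpha\to\alpha'$ changing one $0$ to $1$, of $\pm$ the following map: along the edge either two cycles merge, and one applies $m$ ($\mathbf 1\mathbf 1\mapsto\mathbf 1$, $\mathbf 1X,X\mathbf 1\mapsto X$, $XX\mapsto0$), or one cycle splits, and one applies $\Delta$ ($\mathbf 1\mapsto\mathbf 1X+X\mathbf 1$, $X\mapsto XX$), with the identity on all other cycles (for checkerboard colorable diagrams no edge preserves the number of cycles). The signs are chosen so that every square of the cube anticommutes, e.g. $(-1)^{\#\{1\text{'s before the changed position}\}}$; the result does not depend on this choice up to isomorphism. $Kh^{i,j}(D)$ is the homology. *)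

(* Defs.v *)
From HB Require Import structures.
From mathcomp Require Import all_boot all_order all_algebra all_fingroup all_field.

Set Implicit Arguments.
Unset Strict Implicit.
Unset Printing Implicit Defensive.

Import Order.TTheory GRing.Theory Num.Theory.
Local Open Scope ring_scope.

(* The connected components of the graph of e, as a set of vertex sets; only  *)
(* used when connect e is symmetric.                                          *)
Definition components (T : finType) (e : rel T) : {set {set T}} :=
  [set [set y | connect e x y] | x : T].

(* An oriented link diagram cellularly embedded in a closed oriented surface, *)
(* as a signed Gauss code.  The crossing c is passed twice: at (c, true) by   *)
(* the over-strand, at (c, false) by the under-strand; travelling along the   *)
(* link, the passage after p is next_pass p.  The cyclic order of the four    *)
(* ends at c is determined by the sign of c.                                  *)
Record diagram := Diagram {
  crossing : finType;
  positive : pred crossing;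
  next_pass : {perm crossing * bool};
  circles : nat  (* number of components without crossings *)
}.

Section Diagram.

Variable D : diagram.

Notation C := (crossing D).

Definition writhe (c : C) : int := if positive c then 1 else -1.

Definition n_pos : nat := #|[set c : C | positive c]|.
Definition n_neg : nat := #|[set c : C | ~~ positive c]|.

(* (c, b, o) is the end at c of the over-strand (b = true) or of the          *)
(* under-strand (b = false), outgoing (o = true) or incoming (o = false).     *)
Definition dart : finType := (C * bool * bool)%type.

(* The other end of the arc of D starting at a dart. *)
Definition arc (d : dart) : dart :=
  let: (p, o) := d in
  if o then (next_pass D p, false) else ((next_pass D)^-1%g p, true).

(* The next dart counterclockwise around the crossing.  The counterclockwise  *)
(* order is over-out, under-out, over-in, under-in at a positive crossing and *)
(* over-out, under-in, over-in, under-out at a negative one.                  *)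
Definition rot (d : dart) : dart :=
  let: (c, b, o) := d in (c, ~~ b, o (+) (b (+) positive c)).

Definition num_components : nat :=
  #|components [rel x y : dart | (y == rot x) || (y == arc x)]| + circles D.

Definition connected : Prop := num_components = 1%N.

Definition alternating : Prop :=
  forall p : C * bool, (next_pass D p).2 = ~~ p.2.

(* The corner d is the sector swept out from d counterclockwise to rot d.     *)
(* Following the boundary of its region along the arc at rot d, one enters    *)
(* the corner arc (rot d).  So the regions touching a crossing are the orbits *)
(* of arc \o rot; a component without crossings lies on a sphere of its own   *)
(* and has a region on either side.  Only the elements of regions below are   *)
(* actual regions.                                                            *)
Definition region : finType := ({set dart} + 'I_(circles D) * bool)%type.

Definition region_at (d : dart) : region :=
  inl [set e | fconnect (arc \o rot) d e].

Definition regions : {set region} :=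
  [set region_at d | d : dart] :|: [set inr k | k : 'I_(circles D) * bool].

(* Vertices - edges + faces for the components with crossings, plus 2 for     *)
(* each sphere carrying a component without crossings.                        *)
Definition euler_char : int :=
  #|C|%:Z - (2 * #|C|)%:Z + #|components (frel (arc \o rot))|%:Z
  + (2 * circles D)%:Z.

(* Meaningful for connected D. *)
Definition has_genus (g : nat) : Prop := euler_char = 2 - 2 * g%:Z.

(* true is black, false is white *)
Definition coloring := region -> bool.

(* The two sides of an arc at its end rot d are the corners d and rot d. *)
Definition checkerboard (xi : coloring) : Prop :=
  (forall d : dart, xi (region_at d) != xi (region_at (rot d))) /\
  (forall k : 'I_(circles D), xi (inr (k, true)) != xi (inr (k, false))).

Definition dual_coloring (xi : coloring) : coloring := fun r => ~~ xi r.

(* Rotating the over-strand counterclockwise to the under-strand sweeps out   *)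
(* the corners (c, true, true) and (c, true, false), which have the same      *)
(* color in a checkerboard coloring.                                          *)
Definition incidence (xi : coloring) (c : C) : int :=
  if [forall o, xi (region_at (c, true, o))] then 1 else -1.

Definition typeII (xi : coloring) (c : C) : bool :=
  writhe c * incidence xi c == 1.

Definition adjacent (c : C) (r : region) : bool :=
  [exists d : bool * bool, region_at (c, d.1, d.2) == r].

Definition white_enum (xi : coloring) (m : nat) (X : 'I_m.+1 -> region) : Prop :=
  injective X /\
  forall r, (r \in codom X) = (r \in regions) && ~~ xi r.

Definition goeritz_off (xi : coloring) (r s : region) : int :=
  - \sum_(c : C | adjacent c r && adjacent c s) incidence xi c.

Definition goeritz_entry (xi : coloring) (m : nat) (X : 'I_m.+1 -> region)
    (i j : 'I_m.+1) : int :=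
  if i == j then - \sum_(k | k != i) goeritz_off xi (X i) (X k)
  else goeritz_off xi (X i) (X j).

Definition goeritz (xi : coloring) (m : nat) (X : 'I_m.+1 -> region) : 'M[int]_m :=
  \matrix_(i, j) goeritz_entry xi X (lift ord0 i) (lift ord0 j).

Definition correction (xi : coloring) : int :=
  \sum_(c : C | typeII xi c) incidence xi c.

End Diagram.

(* With multiplicity. *)
Definition eigenvalues (m : nat) (A : 'M[algC]_m) : seq algC :=
  sval (closed_field_poly_normal (char_poly A)).

(* For the order of algC, only real numbers compare with 0. *)
Definition sig (m : nat) (A : 'M[int]_m) : int :=
  let s := eigenvalues (map_mx intr A) in
  (count (fun z => 0 < z) s)%:Z - (count (fun z => z < 0) s)%:Z.

Definition signature (D : diagram) (xi : coloring D)
    (m : nat) (X : 'I_m.+1 -> region D) : int :=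
  sig (goeritz xi X) - correction xi.

Section Khovanov.

Variable D : diagram.

Notation C := (crossing D).

(* A state is the set of its 1-smoothed crossings. *)
Definition state : finType := {set C}.

(* The 0-smoothing merges the corners at the two over-darts, so it cuts off   *)
(* the corners at the two under-darts: each under-dart d is joined to rot d.  *)
(* The 1-smoothing joins each over-dart d to rot d.                           *)
Definition smoothing_joins (a : state) (d e : dart D) : bool :=
  let: (c, b, _) := d in (b == (c \in a)) && (e == rot d).

Definition state_rel (a : state) : rel (dart D) :=
  [rel d e | [|| e == arc d, smoothing_joins a d e | smoothing_joins a e d]].

Definition cycle_id : finType := ({set dart D} + 'I_(circles D))%type.

Definition cycles (a : state) : {set cycle_id} :=
  [set inl B | B in components (state_rel a)] :|: [set inr k | k : 'I_(circles D)].

(* A state together with a labeling of its cycles by 1 or X, given by the set *)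
(* of cycles labeled X.  The labelings of the cycles of a form the standard   *)
(* basis of the tensor power of V.                                            *)
Definition generator : finType :=
  {x : state * {set cycle_id} | x.2 \subset cycles x.1}.

Definition gen_state (x : generator) : state := (val x).1.
Definition gen_X (x : generator) : {set cycle_id} := (val x).2.

Definition hom_degree (x : generator) : int := #|gen_state x|%:Z - (n_neg D)%:Z.

Definition quantum_degree (x : generator) : int :=
  #|cycles (gen_state x) :\: gen_X x|%:Z - #|gen_X x|%:Z
  + (#|gen_state x|%:Z + (n_pos D)%:Z - 2 * (n_neg D)%:Z).

Definition edge_sign (a : state) (c : C) : rat :=
  (-1) ^+ #|[set e in a | (enum_rank e < enum_rank c)%N]|.

(* The coefficient of y in the image of x under m or Delta, for an edge of    *)
(* the cube from the state of x to the state of y.  A cycle which does not    *)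
(* pass through the changed crossing is a cycle of both states, as a set of   *)
(* darts.  The pairs list the possible numbers of labels X before and after.  *)
Definition edge_coef (x y : generator) : rat :=
  let: a := gen_state x in
  let: a' := gen_state y in
  let: common := cycles a :&: cycles a' in
  let: old := cycles a :\: cycles a' in
  let: new := cycles a' :\: cycles a in
  let: labels := (#|gen_X x :&: old|, #|gen_X y :&: new|) in
  if gen_X x :&: common != gen_X y :&: common then 0
  else if (#|old| == 2%N) && (#|new| == 1%N) then
    (labels \in [:: (0%N, 0%N); (1%N, 1%N)])%:R
  else if (#|old| == 1%N) && (#|new| == 2%N) then
    (labels \in [:: (0%N, 1%N); (1%N, 2%N)])%:R
  else 0.

Definition diff_coef (x y : generator) : rat :=
  \sum_(c : C | (c \notin gen_state x) && (gen_state y == c |: gen_state x))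
    edge_sign (gen_state x) c * edge_coef x y.

Definition chain := {ffun generator -> rat^o}.

Definition differential (f : chain) : chain :=
  [ffun y => \sum_x f x * diff_coef x y].

Fact differential_is_linear : linear differential.
Proof.
move=> k f g; apply/ffunP => y; rewrite !ffunE scaler_sumr -big_split /=.
by apply: eq_bigr => x _; rewrite !ffunE mulrDl scalerAl.
Qed.

HB.instance Definition _ :=
  GRing.isLinear.Build rat chain chain _ differential differential_is_linear.

Definition basis_chain (x : generator) : chain := [ffun y => (y == x)%:R].

Definition chains (i j : int) : {vspace chain} :=
  <<[seq basis_chain x | x <- enum generator
      & (hom_degree x == i) && (quantum_degree x == j)]>>%VS.

Definition cocycles (i j : int) : {vspace chain} :=
  (chains i j :&: lker (linfun differential))%VS.

Definition coboundaries (i j : int) : {vspace chain} :=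
  (linfun differential @: chains (i - 1) j)%VS.

(* The quotient of the cocycles by the coboundaries, realized as a complement *)
(* of the coboundaries in the cocycles.                                       *)
Definition Kh (i j : int) : {vspace chain} :=
  (cocycles i j :\: coboundaries i j)%VS.

End Khovanov.

Section FirstReturn.

Variables (T : finType) (f : {perm T}) (P : pred T).

Definition first_return (x : T) : T := head x (filter P (fingraph.orbit f (f x))).

Fact first_return_iter x : P x ->
  exists k, [/\ first_return x = iter k.+1 f x, P (iter k.+1 f x)
              & forall i, (i < k)%N -> ~~ P (iter i.+1 f x)].
Proof.
move=> Px; have hasP : has P (fingraph.orbit f (f x)).
  apply/hasP; exists x => //; rewrite -fconnect_orbit.
  by rewrite fconnect_sym ?fconnect1 //; apply: perm_inj.
pose s := fingraph.orbit f (f x); exists (find P s).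
have nthE i : (i < size s)%N -> nth x s i = iter i.+1 f x.
  move=> ltis; rewrite (set_nth_default (f x)) // iterSr nth_traject //.
  by rewrite size_traject in ltis.
have ltfs : (find P s < size s)%N by rewrite -has_find.
have retE : first_return x = nth x s (find P s).
  rewrite /first_return -/s; move: hasP; rewrite -/s.
  by elim: (s) => //= y t IHt; case: ifP.
split; first by rewrite retE nthE.
  by rewrite -nthE // nth_find.
by move=> i ltif; rewrite -nthE ?(ltn_trans ltif) // (before_find x ltif).
Qed.

Fact first_returnP x : P x -> P (first_return x).
Proof. by case/first_return_iter => k [-> ]. Qed.

Fact first_return_inj x y :
  P x -> P y -> first_return x = first_return y -> x = y.
Proof.
have iter_inj n : injective (iter n f).
  by elim: n => //= n IHn a b /perm_inj /IHn.
have wlog_le a b k l : P a -> (forall i, (i < l)%N -> ~~ P (iter i.+1 f b)) ->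
    (k <= l)%N -> iter k.+1 f a = iter l.+1 f b -> a = b.
  move=> Pa Nb lekl; rewrite -(subnKC lekl) -addSn iterD => /iter_inj.
  case def_i: (l - k)%N => [|i] // def_a.
  have ltil : (i < l)%N by rewrite -(subnKC lekl) def_i addnS ltnS leq_addl.
  by case/negP: (Nb i ltil); rewrite -def_a.
move=> Px Py; have [k [-> _ Nx]] := first_return_iter Px.
have [l [-> _ Ny]] := first_return_iter Py.
case: (leqP k l) => [lekl | /ltnW lelk]; first exact: wlog_le.
by move/esym => eqxy; apply/esym; apply: (wlog_le _ _ l k).
Qed.

End FirstReturn.

(* A generic collection of oriented closed curves in the plane is given by    *)
(* the diagram of all its double points: genus 0 for each component.  At a    *)
(* virtual double point the choice of the strand labeled true is arbitrary,   *)
(* the sign recording the planar picture relative to it.                      *)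
Record virtual_diagram := VirtualDiagram {
  shadow : diagram;
  shadow_planar : euler_char shadow = 2 * (num_components shadow)%:Z;
  virtual : pred (crossing shadow)
}.

Section Classical.

Variable D : virtual_diagram.

Notation S := (shadow D).

Definition classical_crossing : finType := {c : crossing S | ~~ virtual c}.

Definition classical_next (p : classical_crossing * bool) :
    classical_crossing * bool :=
  let: q := first_return (next_pass S) (fun q => ~~ virtual q.1) (val p.1, p.2) in
  (insubd p.1 q.1, q.2).

Fact classical_next_inj : injective classical_next.
Proof.
pose P (q : crossing S * bool) := ~~ virtual q.1.
pose u (p : classical_crossing * bool) := (val p.1, p.2).
have Pu p : P (u p) by apply: (valP p.1).
have uE p : u (classical_next p) = first_return (next_pass S) P (u p).
  rewrite /u /classical_next /= insubdK; first by case: (first_return _ _ _).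
  exact: (first_returnP (next_pass S) (Pu p)).
have u_inj : injective u by move=> [x b] [y c] [/val_inj -> ->].
move=> p q /(congr1 u); rewrite !uE => eqpq.
exact/u_inj/(first_return_inj (Pu p) (Pu q) eqpq).
Qed.

(* The diagram on the surface obtained by letting the strands pass each other *)
(* at the virtual crossings.  The curves without classical crossings are the  *)
(* circles of the shadow and the curves with only virtual double points.      *)
Definition surface_diagram : diagram := {|
  crossing := classical_crossing;
  positive := fun c => positive (val c);
  next_pass := perm classical_next_inj;
  circles := circles S
    + #|[set B in porbits (next_pass S) | [forall q in B, virtual q.1]]|
|}.

End Classical.

(* Main.v *)
(* Proof idea. When all incidence numbers are -1, the colors of the four      *)
(* corners at a crossing are determined by the crossing information, and the  *)
(* cycles of the state a are the orbits on the over-darts of a permutation    *)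
(* s_a with s_(a + c) = (c, true)(c, false) s_a. Every edge of the cube thus  *)
(* merges or splits, s_0 has as many orbits as there are black regions and    *)
(* s_1 as there are white ones.                                               *)
(*   For the support, consider the subcubes in which the crossings outside F  *)
(* are smoothed, restricted to the generators with a prescribed label on the  *)
(* cycles through marked points, one in each connected component. We bound    *)
(* diagonal = j - 2i - n_+ on their homology by the numbers of cycles of the  *)
(* extreme states, by induction on F. Let c be the first unresolved crossing  *)
(* met from a mark. If both smoothings of c keep the components, use the long *)
(* exact sequence. If one of them disconnects, mark the new component at c;   *)
(* one of the two labels of the new mark gives a subcomplex or a quotient     *)
(* with the same bounds, and m or Delta cancels all the other generators.     *)
(*   The Goeritz matrices are definite, being up to sign reduced Laplacians   *)
(* of connected graphs, and the Euler characteristic relates their sizes.     *)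

Require Import Defs.
From mathcomp Require Import all_boot all_order all_algebra all_fingroup all_field.
From mathcomp Require Import zify.

Set Implicit Arguments.
Unset Strict Implicit.
Unset Printing Implicit Defensive.

Import Order.TTheory GRing.Theory Num.Theory.
Local Open Scope ring_scope.

(** Write k(a) for the number of cycles of a state a, and [diagonal] for j - 2i - n_+. The
    differential lowers it by 2 and its parity is constant ([odd_diagonal]), so the task is to bound
    it wherever homology survives. Chains alone give no such bound: generators may lie far outside
    the claimed lines.

    Since the diagram alternates, arcs and smoothing arcs all join an over-dart to an under-dart.
    Walking every cycle in this direction turns a state into a permutation, and changing one
    smoothing multiplies it by a transposition ([cycle_perm_add]).

    The core is [exact_subcube], on partly resolved diagrams with one labeled point in each
    component. The crossing to be removed is chosen on a marked cycle ([next_crossing]). If one of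
    its smoothings disconnects, the known label at the mark makes m or Delta cancel everything but a
    subcube with the same bounds ([exact_disconnected0], [exact_disconnected1]); otherwise the two
    faces inherit the bounds ([exact_connected]). For the whole diagram, [exact_total] confines the
    homology to diagonals between k(setT) - n - 2 and 2 - k(set0), where n is the number of
    crossings.

    The cycles of the two extreme states are the white and the black regions ([card_regions_over],
    [card_regions_under]), numbering m + 1 and m' + 1. The Goeritz matrices are definite
    ([sig_goeritz]), so the signatures are n_- - m and m' - n_+, and n = m + m' + 2g ([euler]) turns
    the interval into g + 2 lines. *)

Local Notation arc := (@Defs.arc _).
Local Notation rot := (@Defs.rot _).
Local Notation cycle_id := Defs.cycle_id.

(** * Exactness of finite complexes *)

Section Exactness.

Variables (F : fieldType) (T : finType) (d : T -> T -> F) (gr : T -> int).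

(** The grading is meant to be j - 2i: the differential raises i by 1 and keeps j. *)
Definition homogeneous := forall x y, d x y != 0 -> gr y = gr x - 2.

Definition square_zero (G : {set T}) :=
  forall x z, x \in G -> z \in G -> \sum_(y in G) d x y * d y z = 0.

(* The complex spanned by G, with the coefficients of d between elements of   *)
(* G, is exact in degree n.                                                   *)
Definition exact_at (G : {set T}) (n : int) := forall f : T -> F,
  (forall x, f x != 0 -> (x \in G) && (gr x == n)) ->
  (forall y, y \in G -> \sum_(x in G) f x * d x y = 0) ->
  exists2 h : T -> F,
    forall x, h x != 0 -> (x \in G) && (gr x == n + 2)
  & forall y, y \in G -> \sum_(x in G) h x * d x y = f y.

Lemma neq0P (x : F) : reflect (x = 0) (~~ (x != 0)).
Proof. by rewrite negbK; apply: eqP. Qed.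

Lemma big_setU_split (G1 G2 : {set T}) (f : T -> F) : [disjoint G1 & G2] ->
  \sum_(x in G1 :|: G2) f x = \sum_(x in G1) f x + \sum_(x in G2) f x.
Proof. by move=> dis; rewrite (eq_bigl [predU G1 & G2]) ?bigU // => x; rewrite !inE. Qed.

Lemma square_zero_split (G1 G2 : {set T}) : [disjoint G1 & G2] ->
    (forall x y, x \in G1 -> y \in G2 -> d x y = 0) ->
  square_zero (G1 :|: G2) -> square_zero G1 /\ square_zero G2.
Proof.
move=> dis d12 sq0; split=> x z Gx Gz.
  have := sq0 x z; rewrite !inE Gx Gz => /(_ isT isT).
  rewrite big_setU_split // [X in _ + X]big1 ?addr0 // => y Gy.
  by rewrite d12 // mul0r.
have := sq0 x z; rewrite !inE Gx Gz !orbT => /(_ isT isT).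
rewrite big_setU_split // [X in X + _]big1 ?add0r // => y Gy.
by rewrite (d12 y) // mulr0.
Qed.

Lemma boundary_closed (G : {set T}) (h : T -> F) : square_zero G ->
    (forall x, h x != 0 -> x \in G) -> forall z, z \in G ->
  \sum_(y in G) (\sum_(x in G) h x * d x y) * d y z = 0.
Proof.
move=> sq0 hG z Gz; under eq_bigr do rewrite mulr_suml.
rewrite exchange_big big1 // => x Gx.
by under eq_bigr do rewrite -mulrA; rewrite -mulr_sumr sq0 // mulr0.
Qed.

(* The long exact sequence of a subcomplex G1 with quotient G2. *)
Lemma exact_at_split (G1 G2 : {set T}) n : homogeneous -> [disjoint G1 & G2] ->
    (forall x y, x \in G1 -> y \in G2 -> d x y = 0) ->
  square_zero (G1 :|: G2) -> exact_at G1 n -> exact_at G2 n ->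
  exact_at (G1 :|: G2) n.
Proof.
move=> hom dis d12 sq0 ex1 ex2 f supp_f cyc_f.
have notG x : x \in G2 -> x \notin G1 by move=> Gx; rewrite (disjointFl dis).
pose f2 x := if x \in G2 then f x else 0.
have [x|y Gy|h2 supp2 bnd2] := ex2 f2.
- rewrite /f2; case: ifP => [Gx nz|_]; last by rewrite eqxx.
  by rewrite /=; case/andP: (supp_f x nz).
- have := cyc_f y; rewrite !inE Gy orbT big_setU_split // => /(_ isT).
  rewrite big1 ?add0r => [|x Gx]; last by rewrite d12 ?mulr0.
  by apply: etrans; apply: eq_bigr => x Gx; rewrite /f2 Gx.
have h2G x : h2 x != 0 -> x \in G1 :|: G2.
  by move=> /supp2 /andP[Gx _]; rewrite !inE Gx orbT.
(* Subtracting the boundary of [h2] from [f] leaves a cycle that vanishes on [G2], hence a cycle of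
   the subcomplex. *)
pose f1 y := if y \in G1 then f y - \sum_(x in G1 :|: G2) h2 x * d x y else 0.
have f1E y : y \in G1 :|: G2 ->
    f1 y = f y - \sum_(x in G1 :|: G2) h2 x * d x y.
  rewrite inE /f1; case: ifP => // G1y /= G2y; rewrite big_setU_split //.
  rewrite big1 ?add0r => [|x Gx]; last by rewrite d12 ?mulr0.
  by rewrite bnd2 // /f2 G2y subrr.
have [y||h1 supp1 bnd1] := ex1 f1.
- rewrite /f1; case: ifP => [Gy nz|_]; last by rewrite eqxx.
  rewrite /=; case: (f y =P 0) nz => [->|/eqP /supp_f /andP[_ ->] //].
  rewrite sub0r oppr_eq0 => nz; have /existsP[x] : [exists x, h2 x * d x y != 0].
    apply: contraR nz => /existsPn all0.
    by apply/eqP/big1 => x _; apply/neq0P.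
  rewrite mulf_eq0 => /norP[/supp2 /andP[_ /eqP grx] /hom ->].
  by apply/eqP; lia.
- move=> z Gz; have Gz' : z \in G1 :|: G2 by rewrite inE Gz.
  have: \sum_(y in G1 :|: G2) f1 y * d y z = 0.
    have := congr2 (fun u v => u - v) (cyc_f z Gz') (boundary_closed sq0 h2G Gz').
    rewrite subrr -sumrB; apply: etrans.
    by apply: eq_bigr => y Gy; rewrite f1E // mulrBl.
  rewrite big_setU_split // [X in _ + X]big1 ?addr0 // => y Gy.
  by rewrite /f1 (negPf (notG y Gy)) mul0r.
exists (fun x => h1 x + h2 x) => [x|y Gy].
  rewrite inE; case: (h1 x =P 0) => [->|/eqP /supp1 /andP[-> ->] //].
  by rewrite add0r => /supp2 /andP[-> ->]; rewrite orbT.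
under eq_bigr do rewrite mulrDl.
rewrite big_split /= -[f y](subrK (\sum_(x in G1 :|: G2) h2 x * d x y)).
rewrite -f1E //; congr (_ + _); rewrite big_setU_split //.
rewrite [X in _ + X]big1 ?addr0 => [|x Gx]; last first.
  have -> : h1 x = 0; last by rewrite mul0r.
  by apply/neq0P/negP => /supp1 /andP[]; rewrite (negPf (notG x Gx)).
have [Gy1|Gy1] := boolP (y \in G1); first exact: bnd1.
rewrite /f1 (negPf Gy1) big1 // => x Gx; rewrite d12 ?mulr0 //.
by move: Gy; rewrite inE (negPf Gy1).
Qed.

(** The block of [d] from [G2] to [G1] is monomial and invertible, which suffices whatever the other
    blocks are: a boundary from [G2] corrects a cycle until it vanishes on [G1], and a cycle
    supported on [G2] is zero because the block is injective. *)
Lemma exact_at_matching (G1 G2 : {set T}) (h h' : T -> T) n :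
    homogeneous -> [disjoint G1 & G2] -> square_zero (G1 :|: G2) ->
    (forall x, x \in G2 -> h x \in G1 /\ d x (h x) != 0) ->
    (forall y, y \in G1 -> h' y \in G2 /\ d (h' y) y != 0) ->
    (forall x y, x \in G2 -> y \in G1 -> d x y != 0 -> y = h x /\ x = h' y) ->
  exact_at (G1 :|: G2) n.
Proof.
move=> hom dis sq0 hP h'P uniq_h f supp_f cyc_f.
have notG x : x \in G2 -> x \notin G1 by move=> Gx; rewrite (disjointFl dis).
have hK x : x \in G2 -> h' (h x) = x.
  by move=> Gx; have [Gh nz] := hP x Gx; have [] := uniq_h _ _ Gx Gh nz.
have h'K y : y \in G1 -> h (h' y) = y.
  by move=> Gy; have [Gh nz] := h'P y Gy; have [] := uniq_h _ _ Gh Gy nz.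
(* Chosen so that its boundary agrees with [f] on [G1]. *)
pose b x := if x \in G2 then f (h x) / d x (h x) else 0.
have suppb x : b x != 0 -> (x \in G1 :|: G2) && (gr x == n + 2).
  rewrite /b inE orbC; case: ifP => [Gx|_]; last by rewrite eqxx.
  rewrite mulf_eq0 => /norP[/supp_f /andP[_ /eqP grh] _] /=.
  by have [_ /hom] := hP x Gx; rewrite grh => ->; rewrite subrK.
have sumG2 (u : T -> F) y : y \in G1 -> (forall x, x \in G1 -> u x = 0) ->
    \sum_(x in G1 :|: G2) u x * d x y = u (h' y) * d (h' y) y.
  move=> Gy u0; rewrite big_setU_split // big1 ?add0r => [|x /u0->]; last exact: mul0r.
  have [Gh _] := h'P y Gy; rewrite (bigD1 (h' y)) //= big1 ?addr0 // => x /andP[Gx neq].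
  apply/eqP; rewrite mulf_eq0; apply/orP; right; apply: contraR neq => nz.
  by have [_ <-] := uniq_h x y Gx Gy nz.
have bE y : y \in G1 -> \sum_(x in G1 :|: G2) b x * d x y = f y.
  move=> Gy; have [Gh nz] := h'P y Gy; rewrite sumG2 // => [|x Gx].
    by rewrite /b Gh h'K // divfK.
  by rewrite /b; case: ifP => // /notG; rewrite Gx.
exists b => // y; rewrite inE => /orP[/bE //|Gy].
have Gy' : y \in G1 :|: G2 by rewrite inE Gy orbT.
have [Gh nz] := hP y Gy.
pose f' y := if y \in G1 :|: G2
  then f y - \sum_(x in G1 :|: G2) b x * d x y else 0.
have f'0 x : x \in G1 -> f' x = 0 by move=> Gx; rewrite /f' inE Gx bE // subrr.
have: \sum_(x in G1 :|: G2) f' x * d x (h y) = 0.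
  have Gh' : h y \in G1 :|: G2 by rewrite inE Gh.
  have bG x : b x != 0 -> x \in G1 :|: G2 by move=> /suppb /andP[].
  have := congr2 (fun u v => u - v) (cyc_f _ Gh') (boundary_closed sq0 bG Gh').
  rewrite subrr -sumrB; apply: etrans.
  by apply: eq_bigr => x Gx; rewrite /f' Gx mulrBl.
rewrite sumG2 // hK // => /eqP; rewrite mulf_eq0 (negPf nz) orbF.
by rewrite /f' Gy' subr_eq0 => /eqP ->.
Qed.

Lemma exact_at_degree (G : {set T}) n :
  (forall x, x \in G -> gr x != n) -> exact_at G n.
Proof.
move=> grG f supp_f _; exists (fun=> 0) => [x|y Gy]; first by rewrite eqxx.
rewrite big1 => [|x _]; last exact: mul0r.
by apply/esym/neq0P/negP => /supp_f /andP[_]; rewrite (negPf (grG y Gy)).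
Qed.

End Exactness.

(** * Merging two classes *)

Section Merging.

Variables (T : finType) (U V : eqType) (f : T -> U) (g : T -> V).

Definition near (p q t : T) := (f t == f p) || (f t == f q).

(* The classes of g are those of f, except that those of p and q are joined. *)
Definition merged (p q : T) := f p != f q /\
  forall t u, (g t == g u) = (f t == f u) || near p q t && near p q u.

Lemma near_sym p q t : near p q t = near q p t.
Proof. exact: orbC. Qed.

Lemma nearl p q : near p q p.
Proof. by rewrite /near eqxx. Qed.

Lemma nearr p q : near p q q.
Proof. by rewrite /near eqxx orbT. Qed.

Lemma near_eq p q t u : f t = f u -> near p q t = near p q u.
Proof. by rewrite /near => ->. Qed.

Lemma merged_sym p q : merged p q -> merged q p.
Proof.
by case=> neq gE; split=> [|t u]; [rewrite eq_sym | rewrite gE !(near_sym p q)].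
Qed.

Variables p q : T.
Hypothesis fg : merged p q.

Lemma merged_neq : f p != f q. Proof. by case: fg. Qed.

Lemma merged_near t u : near p q t -> (g t == g u) = near p q u.
Proof.
case: fg => _ -> nt; rewrite nt orb_idl // => /eqP /near_eq ftu.
by rewrite -ftu.
Qed.

Lemma merged_far t u : ~~ near p q t -> (g t == g u) = (f t == f u).
Proof. by case: fg => _ -> /negPf->; rewrite orbF. Qed.

Lemma merged_eq : g p = g q.
Proof. by apply/eqP; rewrite merged_near ?nearl ?nearr. Qed.

Lemma merged_fine t u : f t = f u -> g t = g u.
Proof. by move=> ftu; apply/eqP; case: fg => _ ->; rewrite ftu eqxx. Qed.

Lemma nearE t : near p q t = (g t == g p).
Proof. by rewrite eq_sym merged_near ?nearl. Qed.

Lemma count_near s : count (fun u => g p == g u) s =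
  (count (fun u => f p == f u) s + count (fun u => f q == f u) s)%N.
Proof.
rewrite -count_predUI [X in (_ + X)%N](eq_count (a2 := pred0)) => [|u] /=; last first.
  by apply: contraNF merged_neq => /andP[/eqP-> /eqP->].
rewrite count_pred0 addn0; apply: eq_count => u /=.
by rewrite merged_near ?nearl // /near ![_ == f u]eq_sym.
Qed.

Lemma count_far t s : ~~ near p q t ->
  count (fun u => g t == g u) s = count (fun u => f t == f u) s.
Proof. by move=> nt; apply: eq_count => u; apply: merged_far. Qed.

End Merging.

(** * Orbits of a permutation multiplied by a transposition *)

Section Surgery.

Variable T : finType.
Implicit Types (s : {perm T}) (x y t u : T).

Lemma porbit_invariant (U : Type) (k : T -> U) s t u :
  (forall v, k (s v) = k v) -> porbit s t = porbit s u -> k t = k u.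
Proof.
move=> kP /eqP; rewrite eq_porbit_mem porbit_sym => /porbitP[n ->].
by elim: n => [|n IHn]; rewrite ?expg0 ?perm1 // expgSr permM kP.
Qed.

Lemma porbit_app s t : porbit s (s t) = porbit s t.
Proof. by have := porbit_perm s 1 t; rewrite expg1. Qed.

(** If x and y were in different orbits both before and after, multiplying twice by the same
    transposition would lower the number of orbits twice, although the composite is the identity. *)
Lemma merged_tperm s x y : porbit s x != porbit s y ->
  merged (porbit s) (porbit (tperm x y * s)%g) x y.
Proof.
move=> neq; split=> //; set s' := (tperm x y * s)%g.
have nxy : x != y by apply: contraNneq neq => ->.
have eq' : porbit s' x = porbit s' y.
  apply/eqP; rewrite eq_porbit_mem; apply: contraT => nx.
  have := porbits_mul_tperm s' x y; have := porbits_mul_tperm s x y.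
  rewrite /= mulgA tperm2 mul1g -/s' nx nxy -eq_porbit_mem neq /=; lia.
pose k t := if near (porbit s) x y t then porbit s x else porbit s t.
move=> t u; apply/eqP/orP => [eqtu|].
  have: k t = k u.
    apply: porbit_invariant eqtu => v; rewrite /k /s' permM.
    rewrite (near_eq _ _ (porbit_app s _)) porbit_app.
    by case: tpermP => // ->; rewrite ?nearl ?nearr.
  rewrite /k; case: ifP => nt; case: ifP => nu; first by right.
  - by move=> eqxu; rewrite /near -eqxu eqxx in nu.
  - by move=> eqxt; rewrite /near eqxt eqxx in nt.
  by move=> ->; left.
have invs v : porbit s' (s v) = porbit s' v.
  have -> : s v = s' (tperm x y v) by rewrite permM tpermK.
  by rewrite porbit_app; case: tpermP => // ->.
have nearP v : near (porbit s) x y v -> porbit s' v = porbit s' x.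
  by case/orP => /eqP /(porbit_invariant invs) ->; rewrite ?eq'.
case=> [/eqP|/andP[/nearP-> /nearP->] //].
exact: porbit_invariant.
Qed.

Lemma merged_tpermV s x y : x != y -> porbit s x == porbit s y ->
  merged (porbit (tperm x y * s)%g) (porbit s) x y.
Proof.
move=> nxy; rewrite eq_porbit_mem => sxy.
have <- : (tperm x y * (tperm x y * s) = s)%g by rewrite mulgA tperm2 mul1g.
rewrite {1}mulgA tperm2 mul1g; apply: merged_tperm.
rewrite eq_porbit_mem; apply/negP => sxy'.
have := porbits_mul_tperm (tperm x y * s)%g x y.
have := porbits_mul_tperm s x y.
rewrite /= mulgA tperm2 mul1g nxy sxy sxy' /=; lia.
Qed.

End Surgery.

Section MergedOrbits.

Variables (T : finType) (s s' : {perm T}) (p q : T).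
Hypothesis ss' : merged (porbit s) (porbit s') p q.

Lemma merged_porbit_far t : ~~ near (porbit s) p q t -> porbit s' t = porbit s t.
Proof.
by move=> nt; apply/setP => u; rewrite -!eq_porbit_mem !(eq_sym (porbit _ u)) (merged_far ss').
Qed.

(** [edge_coef] compares cycles of two states as sets, so the joined orbits must not recur: an orbit
    of [s] that is also one of [s'] would contain both p and q. *)
Lemma merged_porbit_near t u : near (porbit s) p q t -> porbit s t != porbit s' u.
Proof.
move=> nt; apply/eqP => eqtu.
have eqtu' : porbit s' t = porbit s' u.
  by apply/eqP; rewrite eq_porbit_mem -eqtu porbit_id.
have eqv v : near (porbit s) p q v -> porbit s v = porbit s t.
  move=> nv; apply/eqP; rewrite eq_porbit_mem eqtu -eqtu' -eq_porbit_mem eq_sym.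
  by rewrite (merged_near ss').
have := merged_neq ss'.
by rewrite !eqv ?eqxx ?nearl ?nearr.
Qed.

End MergedOrbits.

(** * Joining components of a graph *)

Section ConnectedClasses.

Variable T : finType.
Implicit Types (e : rel T) (p q t u v : T).

Definition class e t := [set u | connect e t u].

Lemma class_eq e t u : connect_sym e -> (class e t == class e u) = connect e t u.
Proof.
move=> sym; apply/eqP/idP => [/setP /(_ u)|tu]; first by rewrite !inE connect0.
by apply/setP => v; rewrite !inE (same_connect sym tu).
Qed.

Lemma class_invariant (U : Type) (k : T -> U) e t u :
  (forall v w, e v w -> k v = k w) -> connect e t u -> k t = k u.
Proof.
move=> kP /connectP[s + ->] {u}; elim: s t => //= v s IHs t /andP[/kP-> /IHs].
exact.
Qed.

(** In contrast to [merged], the classes of p and q may already coincide: smoothing a crossing need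
    not disconnect anything. *)
Lemma class_join e e' p q : connect_sym e -> connect_sym e' ->
    (forall t u, e t u -> connect e' t u) -> connect e' p q ->
    (forall t u, e' t u -> class e t = class e u \/
       near (class e) p q t /\ near (class e) p q u) ->
  forall t u, (class e' t == class e' u) =
    (class e t == class e u) || near (class e) p q t && near (class e) p q u.
Proof.
move=> sym sym' ee' pq' e'e t u; rewrite class_eq //.
have sub v w : class e v = class e w -> class e' v = class e' w.
  move=> /eqP; rewrite class_eq // => vw; apply: class_invariant vw => v' w' /ee' vw'.
  by apply/eqP; rewrite class_eq.
have nearP v : near (class e) p q v -> class e' v = class e' p.
  have pqE : class e' p = class e' q by apply/eqP; rewrite class_eq.
  by case/orP => /eqP /sub ->.
apply/idP/idP => [tu|].
  pose k v := if near (class e) p q v then class e p else class e v.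
  have: k t = k u.
    apply: class_invariant tu => v w /e'e[vw|[nv nw]]; rewrite /k; last by rewrite nv nw.
    by rewrite (near_eq _ _ vw) vw.
  rewrite /k; case: ifP => nt; case: ifP => nu.
  - by rewrite orbT.
  - by move=> eqpu; rewrite /near -eqpu eqxx in nu.
  - by move=> eqpt; rewrite /near eqpt eqxx in nt.
  by move=> ->; rewrite eqxx.
rewrite -class_eq // => /orP[/eqP /sub -> //|/andP[/nearP-> /nearP->] //].
Qed.

End ConnectedClasses.

(** * Cycles of the states *)

Section States.

Variable D : diagram.
Hypothesis alt : alternating D.

Local Notation C := (crossing D).
Local Notation T := (C * bool)%type.
Implicit Types (d e : dart D) (t u v : T) (a : state D) (c : C).

Lemma arcK : involutive (@Defs.arc D).
Proof. by move=> [p []] /=; rewrite ?permK ?permKV. Qed.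

Lemma rot2 d : rot (rot d) = (d.1, ~~ d.2).
Proof. by case: d => [[c b] o] /=; rewrite negbK; case: b o (positive c) => [] [] []. Qed.

Lemma rot_strand d : (rot d).1 = (d.1.1, ~~ d.1.2).
Proof. by case: d => [[c b] o]. Qed.

Lemma rot4 d : rot (rot (rot (rot d))) = d.
Proof. by rewrite !rot2 /= negbK; case: d. Qed.

Lemma arc_strand d : (arc d).1.2 = ~~ d.1.2.
Proof.
case: d => [p []] /=; first exact: alt.
by rewrite -[in RHS](permKV (next_pass D) p) alt negbK.
Qed.

Definition over t : dart D := (t.1, true, t.2).

(* An arc joins an over-dart to an under-dart; foot d is its over-dart. *)
Definition foot d : T := let: (c, b, o) := if d.1.2 then d else arc d in (c, o).

Lemma over_foot d : over (foot d) = if d.1.2 then d else arc d.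
Proof.
rewrite /foot; have: (if d.1.2 then d else arc d).1.2 = true.
  by case: ifP => // nd; rewrite arc_strand nd.
by case: (if _ then _ else _) => [[c b] o] /= ->.
Qed.

Lemma overK : cancel over foot.
Proof. by case. Qed.

Lemma foot_arc d : foot (arc d) = foot d.
Proof.
apply: (can_inj overK); rewrite !over_foot arc_strand arcK.
by case: (d.1.2).
Qed.

(* The other end of the smoothing arc at d. *)
Definition mate a d := if d.1.2 == (d.1.1 \in a) then rot d else rot (rot (rot d)).

Lemma mate_strand a d : (mate a d).1 = (d.1.1, ~~ d.1.2).
Proof. by rewrite /mate; case: ifP => _; rewrite rot_strand ?rot2. Qed.

Lemma mateK a : involutive (mate a).
Proof.
move=> d; rewrite {1}/mate mate_strand /= /mate.
by case: (d.1.2) (d.1.1 \in a) => [] [] /=; rewrite ?rot4.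
Qed.

Lemma smoothing_joinsE a d e :
  smoothing_joins a d e = (d.1.2 == (d.1.1 \in a)) && (e == rot d).
Proof. by case: d => [[c b] o]. Qed.

Lemma state_relE a d e : state_rel a d e = (e == arc d) || (e == mate a d).
Proof.
rewrite -[LHS]/[|| e == arc d, smoothing_joins a d e | smoothing_joins a e d].
rewrite !smoothing_joinsE; congr (_ || _).
have -> : (e.1.2 == (e.1.1 \in a)) && (d == rot e) =
  (d.1.2 != (d.1.1 \in a)) && (e == rot (rot (rot d))).
  apply/idP/idP=> /andP[].
    move=> eb /eqP->; rewrite rot4 eqxx rot_strand /= andbT.
    by case: (e.1.2) (_ \in _) eb => [] [].
  move=> db /eqP->; rewrite rot4 eqxx rot_strand rot2 /= andbT.
  by case: (d.1.2) (_ \in _) db => [] [].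
by rewrite /mate; case: eqP => _ /=; rewrite ?orbF.
Qed.

Lemma mate_over a t :
  mate a (over t) = rot (over (if t.1 \in a then t else (t.1, ~~ t.2))).
Proof.
rewrite /mate [rot (rot (over t))]rot2 -[(over t).1.1]/(t.1).
by case: (t.1 \in a).
Qed.

(** Smoothing arc first, then arc of the diagram: alternation makes this lead from over-dart to
    over-dart, which orients all cycles of all states at once. *)
Definition step a t := foot (mate a (over t)).

Lemma over_step a t : over (step a t) = arc (mate a (over t)).
Proof. by rewrite over_foot mate_strand. Qed.

Lemma step_inj a : injective (step a).
Proof.
move=> t u /(congr1 over); rewrite !over_step => /(can_inj arcK).
by move=> /(can_inj (@mateK a)) /(can_inj overK).
Qed.

(* Its orbits are the cycles of the state a, recorded by their over-darts. *)
Definition cycle_perm a : {perm T} := perm (@step_inj a).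

Local Notation S a := (porbit (cycle_perm a)).

Lemma connect_state_sym a : connect_sym (state_rel a).
Proof.
apply: sym_connect_sym => d e; rewrite !state_relE.
by rewrite ![e == _]eq_sym (inv_eq arcK) (inv_eq (@mateK a)).
Qed.

Lemma connect_state a d e :
  connect (state_rel a) d e = (foot e \in S a (foot d)).
Proof.
apply/idP/idP.
  have stepP d' e' : state_rel a d' e' -> S a (foot d') = S a (foot e').
    rewrite state_relE => /orP[/eqP->|/eqP->]; first by rewrite foot_arc.
    (* A smoothing arc can be read from either end, so it may start at its over-dart. *)
    wlog d'o : d' / d'.1.2.
      case d'o: (d'.1.2); first by apply.
      move=> /(_ (mate a d')); rewrite mateK mate_strand /= d'o.
      by move=> /(_ isT) ->.
    have -> : foot (mate a d') = cycle_perm a (foot d').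
      by rewrite permE /step over_foot d'o.
    by rewrite porbit_app.
  move=> /connectP[p + ->] {e}; rewrite -eq_porbit_mem eq_sym.
  by elim: p d => [|e p IHp] d //= /andP[/stepP-> /IHp].
have footP d' : connect (state_rel a) d' (over (foot d')).
  rewrite over_foot; case: ifP => // _.
  by rewrite connect1 // state_relE eqxx.
have: foot e \in S a (foot d) -> connect (state_rel a) (over (foot d)) (over (foot e)).
  move=> /porbitP[n ->]; elim: n => [|n IHn]; first by rewrite expg0 perm1.
  apply: connect_trans IHn _; rewrite expgSr permM.
  set t := fun_of_perm (_ ^+ n)%g _; apply: (@connect_trans _ _ (mate a (over t))).
    by rewrite connect1 // state_relE eqxx orbT.
  by rewrite connect1 // permE over_step state_relE eqxx.
move=> h /h de; apply: connect_trans (footP d) (connect_trans de _).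
by rewrite connect_state_sym.
Qed.

Hypothesis no_circles : circles D = 0%N.

Definition cyc a t : cycle_id D := inl [set e | foot e \in S a t].

Lemma cyc_eq a b t u : (cyc a t == cyc b u) = (S a t == S b u).
Proof.
apply/eqP/eqP => [[/setP eqS]|eqS]; last by rewrite /cyc eqS.
by apply/setP => v; have := eqS (over v); rewrite !inE overK.
Qed.

Lemma cyclesP a (k : cycle_id D) : reflect (exists t, k = cyc a t) (k \in cycles a).
Proof.
have compE d : [set e | connect (state_rel a) d e] = [set e | foot e \in S a (foot d)].
  by apply/setP => e; rewrite !inE connect_state.
rewrite inE; apply: (iffP orP) => [[]|[t ->]].
- by case/imsetP => B /imsetP[d _ ->] ->; exists (foot d); rewrite compE.
- by case/imsetP => i; have := ltn_ord i; rewrite {2}no_circles.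
left; apply: imset_f; apply/imsetP; exists (over t) => //.
by rewrite compE overK.
Qed.

Lemma mem_cycles a t : cyc a t \in cycles a.
Proof. by apply/cyclesP; exists t. Qed.

(** By [mate_over], switching the smoothing at c exchanges the partners of the two over-darts of
    c. *)
Lemma cycle_perm_add a c : c \notin a ->
  cycle_perm (c |: a) = (tperm (c, true) (c, false) * cycle_perm a)%g.
Proof.
move=> ca; apply/permP => -[c1 o]; rewrite permM.
have -> : tperm (c, true) (c, false) (c1, o) = (c1, (c1 == c) (+) o).
  case: (eqVneq c1 c) => [->|c1c].
    by case: o; rewrite ?tpermL ?tpermR.
  by rewrite tpermD // xpair_eqE negb_and eq_sym c1c.
rewrite !permE /step !mate_over; congr (foot (rot (over _))); rewrite in_setU1 /=.
case: (eqVneq c1 c) => [->|c1c] //=.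
by rewrite (negPf ca) negbK.
Qed.

Lemma merge_edge a c o : c \notin a -> S a (c, o) != S a (c, ~~ o) ->
  merged (S a) (S (c |: a)) (c, o) (c, ~~ o).
Proof.
move=> ca; rewrite cycle_perm_add //; case: o => /= neq; first exact: merged_tperm.
by apply/merged_sym/merged_tperm; rewrite eq_sym.
Qed.

Lemma split_edge a c o : c \notin a -> S a (c, o) == S a (c, ~~ o) ->
  merged (S (c |: a)) (S a) (c, o) (c, ~~ o).
Proof.
have neq : (c, true) != (c, false) by rewrite xpair_eqE andbF.
move=> ca; rewrite cycle_perm_add //; case: o => /= eqo; first exact: merged_tpermV.
by apply/merged_sym/merged_tpermV => //; rewrite eq_sym.
Qed.

Section MergedStates.

Variables (a b : state D) (p q : T).
Hypothesis ab : merged (S a) (S b) p q.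

Lemma cyc_far t : ~~ near (S a) p q t -> cyc b t = cyc a t.
Proof. by move=> nt; apply/eqP; rewrite cyc_eq (merged_porbit_far ab). Qed.

Lemma cyc_in t : (cyc a t \in cycles b) = ~~ near (S a) p q t.
Proof.
have [nt|nt] := boolP (near _ p q t); last by rewrite -cyc_far // mem_cycles.
apply/negbTE/cyclesP => -[u /eqP]; rewrite cyc_eq.
by rewrite (negPf (merged_porbit_near ab u nt)).
Qed.

Lemma cyc_in' t : (cyc b t \in cycles a) = ~~ near (S a) p q t.
Proof.
have [nt|nt] := boolP (near _ p q t); last by rewrite cyc_far // mem_cycles.
apply/negbTE/cyclesP => -[u /eqP]; rewrite cyc_eq eq_sym.
have [nu|nu] := boolP (near (S a) p q u).
  by rewrite (negPf (merged_porbit_near ab t nu)).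
by rewrite -(merged_porbit_far ab nu) eq_sym (merged_near ab) // (negPf nu).
Qed.

Lemma cycles_diff : cycles a :\: cycles b = [set cyc a p; cyc a q].
Proof.
apply/setP => k; rewrite in_setD in_set2; apply/andP/idP => [[kb /cyclesP[t kE]]|].
  by move: kb; rewrite kE cyc_in negbK !cyc_eq.
by case/orP => /eqP->; rewrite mem_cycles cyc_in ?nearl ?nearr.
Qed.

Lemma cycles_diff' : cycles b :\: cycles a = [set cyc b p].
Proof.
apply/setP => k; rewrite in_setD in_set1; apply/andP/idP => [[ka /cyclesP[t kE]]|/eqP->].
  by move: ka; rewrite kE cyc_in' negbK cyc_eq (nearE ab).
by rewrite mem_cycles cyc_in' nearl.
Qed.

Lemma card_diff : #|cycles a :\: cycles b| = 2%N.
Proof. by rewrite cycles_diff cards2 cyc_eq (merged_neq ab). Qed.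

Lemma card_diff' : #|cycles b :\: cycles a| = 1%N.
Proof. by rewrite cycles_diff' cards1. Qed.

Lemma card_merged : #|cycles a| = #|cycles b|.+1.
Proof.
rewrite -(cardsID (cycles b)) card_diff -(cardsID (cycles a) (cycles b)) card_diff'.
by rewrite setIC !addnS.
Qed.

Lemma commonE (X Y : {set cycle_id D}) :
  (X :&: (cycles a :&: cycles b) == Y :&: (cycles a :&: cycles b)) =
  [forall t, ~~ near (S a) p q t ==> ((cyc a t \in X) == (cyc b t \in Y))].
Proof.
apply/eqP/forallP => [/setP eqXY t|eqXY].
  apply/implyP => nt; have := eqXY (cyc a t).
  by rewrite !in_setI mem_cycles cyc_in nt !andbT -cyc_far // => ->.
apply/setP => k; rewrite !in_setI; have [/cyclesP[t ->]|_] /= := boolP (k \in cycles a).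
  rewrite cyc_in; have [nt|nt] /= := boolP (near _ _ _ _); first by rewrite !andbF.
  by have := eqXY t; rewrite nt !andbT => /eqP ->; rewrite cyc_far.
by rewrite !andbF.
Qed.

Lemma card_in_diff (X : {set cycle_id D}) :
  #|X :&: (cycles a :\: cycles b)| = ((cyc a p \in X) + (cyc a q \in X))%N.
Proof.
rewrite cycles_diff (cardsD1 (cyc a p)) (cardsD1 (cyc a q)) !inE !eqxx orbT !andbT.
rewrite eq_sym cyc_eq (merged_neq ab) /= addnA [X in (_ + X)%N](_ : _ = 0%N) ?addn0 //.
apply/eqP; rewrite cards_eq0; apply/eqP/setP => k; rewrite !inE.
by case: eqP => //=; case: eqP => //=; rewrite andbF.
Qed.

Lemma card_in_diff' (X : {set cycle_id D}) :
  #|X :&: (cycles b :\: cycles a)| = (cyc b p \in X).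
Proof.
rewrite cycles_diff' (cardsD1 (cyc b p)) !inE eqxx andbT.
rewrite [X in (_ + X)%N](_ : _ = 0%N) ?addn0 //.
apply/eqP; rewrite cards_eq0; apply/eqP/setP => k; rewrite !inE.
by case: eqP => //=; rewrite andbF.
Qed.

End MergedStates.

(** * The edges of the cube *)

Implicit Types (x y z w : generator D) (b : state D).

Definition lab x t := cyc (gen_state x) t \in gen_X x.

Lemma lab_eq x t u : S (gen_state x) t = S (gen_state x) u -> lab x t = lab x u.
Proof. by rewrite /lab /cyc => ->. Qed.

Lemma gen_XP x (k : cycle_id D) :
  reflect (exists2 t, k = cyc (gen_state x) t & lab x t) (k \in gen_X x).
Proof.
apply: (iffP idP) => [kX|[t -> //]].
have /cyclesP[t kE] : k \in cycles (gen_state x) by apply: (subsetP (valP x)).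
by exists t => //; rewrite /lab -kE.
Qed.

Lemma gen_eqP x y : gen_state x = gen_state y -> lab x =1 lab y -> x = y.
Proof.
move=> eqS eql; apply: val_inj; rewrite [val x]surjective_pairing [val y]surjective_pairing.
congr (_, _) => //; apply/setP => k; rewrite -[_.2]/(gen_X x) -[(val y).2]/(gen_X y).
by apply/gen_XP/gen_XP => -[t ->]; exists t; rewrite ?eqS -?eql // eql.
Qed.

Lemma mkgen_subproof a (l : pred T) : [set cyc a t | t in l] \subset cycles a.
Proof. by apply/subsetP => k /imsetP[t _ ->]; apply: mem_cycles. Qed.

Definition mkgen a (l : pred T) : generator D :=
  exist _ (a, [set cyc a t | t in l]) (mkgen_subproof a l).

Lemma lab_mkgen a (l : pred T) : (forall t u, S a t = S a u -> l t = l u) ->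
  lab (mkgen a l) =1 l.
Proof.
move=> lP t; apply/imsetP/idP => [[u lu /eqP]|lt]; last by exists t.
by rewrite cyc_eq => /eqP /lP ->.
Qed.

Lemma edge_coef_merge x y p q :
    merged (S (gen_state x)) (S (gen_state y)) p q ->
  edge_coef x y =
    ([forall t, ~~ near (S (gen_state x)) p q t ==> (lab x t == lab y t)]
     && (lab x p + lab x q == lab y p)%N)%:R.
Proof.
move=> xy; rewrite /edge_coef (commonE xy) (card_diff xy) (card_diff' xy) /=.
rewrite (card_in_diff xy) (card_in_diff' xy) /lab.
case: ifP => [/negPf-> //|/negbFE->]; congr (_%:R); rewrite !inE !xpair_eqE.
by case: (cyc _ p \in _) (cyc _ q \in _) (cyc (gen_state y) p \in _) => [] [] [].
Qed.

Lemma edge_coef_split x y p q :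
    merged (S (gen_state y)) (S (gen_state x)) p q ->
  edge_coef x y =
    ([forall t, ~~ near (S (gen_state y)) p q t ==> (lab x t == lab y t)]
     && (lab y p + lab y q == (lab x p).+1)%N)%:R.
Proof.
move=> xy; rewrite /edge_coef (setIC (cycles (gen_state x))) eq_sym (commonE xy).
rewrite (card_diff xy) (card_diff' xy) /= (card_in_diff xy) (card_in_diff' xy) /lab.
under eq_forallb do rewrite eq_sym.
case: ifP => [/negPf-> //|/negbFE->]; congr (_%:R); rewrite !inE !xpair_eqE.
by case: (cyc _ p \in _) (cyc _ q \in _) (cyc (gen_state x) p \in _) => [] [] [].
Qed.

(** By [quantum_degreeE] this is j - 2i - n_+, a quantity that depends only on the state and its
    labels. *)
Definition diagonal x : int :=
  #|cycles (gen_state x)|%:Z - (2 * #|gen_X x|)%:Z - #|gen_state x|%:Z.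

Lemma card_gen_X x b p q : merged (S (gen_state x)) (S b) p q ->
  #|gen_X x| = (#|gen_X x :&: (cycles (gen_state x) :&: cycles b)| + (lab x p + lab x q))%N.
Proof.
move=> xb; rewrite -(card_in_diff xb) -(cardsID (cycles b) (gen_X x)).
by rewrite setIA setIDA (setIidPl (valP x)).
Qed.

Lemma card_gen_X' x b p q : merged (S b) (S (gen_state x)) p q ->
  #|gen_X x| = (#|gen_X x :&: (cycles b :&: cycles (gen_state x))| + lab x p)%N.
Proof.
move=> xb; rewrite -(card_in_diff' xb) -(cardsID (cycles b) (gen_X x)).
by rewrite (setIC (cycles b)) setIA setIDA (setIidPl (valP x)).
Qed.

(** A transposition joins two orbits or cuts one, so no edge preserves the number of cycles. *)
Lemma edge_cases a c o : c \notin a ->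
  {merged (S a) (S (c |: a)) (c, o) (c, ~~ o)} +
  {merged (S (c |: a)) (S a) (c, o) (c, ~~ o)}.
Proof.
move=> ca; case eqS: (S a (c, o) == S a (c, ~~ o)); [right|left].
  exact: split_edge.
by apply: merge_edge; rewrite ?eqS.
Qed.

Lemma edge_coef_diagonal x y c : c \notin gen_state x ->
    gen_state y = c |: gen_state x -> edge_coef x y != 0 ->
  diagonal y = diagonal x - 2.
Proof.
move=> ca yE; rewrite /diagonal yE cardsU1 ca -yE.
have [m|m] := edge_cases true ca; rewrite -yE in m.
  rewrite (edge_coef_merge m) (card_merged m) (card_gen_X m) (card_gen_X' m).
  by rewrite -commonE // pnatr_eq0 eqb0 negbK => /andP[/eqP-> /eqP<-]; lia.
rewrite (edge_coef_split m) (card_merged m) (card_gen_X m) (card_gen_X' m).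
under eq_forallb do rewrite eq_sym.
by rewrite -commonE // pnatr_eq0 eqb0 negbK => /andP[/eqP-> /eqP->]; lia.
Qed.

(** A product with X is X or 0, and Delta X = XX, so a label X is never lost. Prescribing X at a
    point therefore gives a subcomplex, and prescribing 1 a quotient. *)
Lemma edge_coef_lab x y c t : c \notin gen_state x ->
  gen_state y = c |: gen_state x -> edge_coef x y != 0 -> lab x t -> lab y t.
Proof.
move=> ca yE; have [m|m] := edge_cases true ca; rewrite -yE in m.
  rewrite (edge_coef_merge m) pnatr_eq0 eqb0 negbK => /andP[/forallP /(_ t)].
  case nt: (near _ _ _ t) => /=; last by move=> /eqP->.
  move=> _; rewrite (lab_eq (x := y) (u := (c, true))); last first.
    by apply/eqP; rewrite (merged_near m) ?nearl.
  by case/orP: nt => /eqP /lab_eq->; do 3!case: (lab _ _).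
rewrite (edge_coef_split m) pnatr_eq0 eqb0 negbK => /andP[/forallP /(_ t)].
case nt: (near _ _ _ t) => /=; last by move=> /eqP->.
move=> _; rewrite (lab_eq (x := x) (u := (c, true))); last first.
  by apply/eqP; rewrite (merged_near m) ?nearl.
by case/orP: nt => /eqP /lab_eq->; do 3!case: (lab _ _).
Qed.

(** * The square of the differential *)

Implicit Types s : seq T.

(* The word s stands for the product of the variables X_t, t in s, in the     *)
(* quotient of Q[X_t] in which X_t^2 = 0 and the variables of a cycle of a    *)
(* coincide; represents a s x says that this product is the basis element x,  *)
(* and a product which vanishes is represented by no x.                       *)
Definition represents a s x := [forall t, lab x t == count (fun u => S a t == S a u) s :> nat].

Lemma representsP a s x : reflect (forall t, lab x t = count (fun u => S a t == S a u) s :> nat)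
  (represents a s x).
Proof. by apply: (iffP forallP) => h t; apply/eqP/h. Qed.

Lemma represents_uniq s x y : gen_state x = gen_state y ->
  represents (gen_state x) s x -> represents (gen_state x) s y -> x = y.
Proof.
move=> eqS /representsP sx /representsP sy; apply: gen_eqP => // t.
by have := sx t; rewrite -sy; do 2!case: (lab _ t).
Qed.

Lemma represents_ex a s : (forall t, count (fun u => S a t == S a u) s <= 1)%N ->
  exists2 x, gen_state x = a & represents a s x.
Proof.
move=> le1; exists (mkgen a (fun t => 0 < count (fun u => S a t == S a u) s)%N) => //.
apply/representsP => t; rewrite lab_mkgen => [|v u -> //].
by case: (count _ _) (le1 t) => [|[]].
Qed.

Lemma word_ex x : exists s, represents (gen_state x) s x.
Proof.
(* [r] picks one point on each cycle; the word lists those on the cycles labeled X. *)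
set a := gen_state x; pose r t := odflt t [pick u in S a t].
have rE t u : S a t = S a u -> r t = r u.
  by rewrite /r => <-; case: pickP => //= /(_ t); rewrite porbit_id.
have Sr t : S a (r t) = S a t.
  by rewrite /r; case: pickP => [u|//] /=; rewrite -eq_porbit_mem => /eqP.
exists [seq u <- enum {: T} | lab x u && (u == r u)]; apply/representsP => t.
have -> : nat_of_bool (lab x t) = (lab x t * count_mem (r t) (enum {: T}))%N.
  by rewrite count_uniq_mem ?enum_uniq // mem_enum muln1.
rewrite count_filter (eq_count (a2 := fun u => lab x t && (u == r t))) => [|u] /=.
  by case: (lab x t); rewrite ?mul1n // count_pred0.
apply/andP/andP => [[/eqP tu /andP[xu /eqP->]]|[xt /eqP->]].
  by rewrite (rE _ _ tu) (lab_eq tu).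
by rewrite (lab_eq (x := x) (Sr t)) xt Sr (rE _ _ (Sr t)) !eqxx.
Qed.

Lemma representsE a s x p q : gen_state x = a -> represents a s x =
  [&& [forall t, ~~ near (S a) p q t ==> (lab x t == count (fun u => S a t == S a u) s :> nat)],
      lab x p == count (fun u => S a p == S a u) s :> nat
    & lab x q == count (fun u => S a q == S a u) s :> nat].
Proof.
move=> <- {a}; apply/representsP/and3P => [sx|[/forallP sx /eqP sp /eqP sq] t].
  by split; [apply/forallP => t; apply/implyP => _ | |]; rewrite sx.
have := sx t; case nt: (near _ _ _ t) => /=; last by move=> /eqP.
by move=> _; case/orP: nt => /eqP nt; rewrite (lab_eq nt) nt.
Qed.

(* On words, m is the identity and Delta the multiplication by the sum of the *)
(* variables of the two new cycles.                                           *)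
Definition edge_words a c s :=
  if S a (c, true) == S a (c, false) then [:: (c, true) :: s; (c, false) :: s] else [:: s].

Lemma represents_edge a c s x y : c \notin a -> gen_state x = a ->
  gen_state y = c |: a -> represents a s x ->
  edge_coef x y = \sum_(w <- edge_words a c s) (represents (c |: a) w y)%:R.
Proof.
move=> ca xa yb /representsP sx; rewrite /edge_words; case: ifPn => ac.
  have m := split_edge (o := true) ca ac; have := m; rewrite -{1}yb -{1}xa => m'.
  rewrite !big_cons big_nil addr0 (edge_coef_split m') -natrD !(representsE _ (c, true) (c, false) yb).
  have := count_near m s; rewrite -sx /= !eqxx (negPf (merged_neq m)).
  rewrite eq_sym in ac; rewrite [S (c |: a) (c, false) == _]eq_sym (negPf (merged_neq m)) yb.
  have farE o : [forall t, ~~ near (S (c |: a)) (c, true) (c, false) t ==>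
      (lab y t == (S (c |: a) t == S (c |: a) (c, o))
         + count (fun u => S (c |: a) t == S (c |: a) u) s :> nat)%N] =
      [forall t, ~~ near (S (c |: a)) (c, true) (c, false) t ==> (lab x t == lab y t)].
    apply: eq_forallb => t; case nt: (near _ _ _ t) => //=.
    rewrite -(count_far m) ?nt // -sx (_ : (S _ t == _) = false) //.
      by do 2!case: (lab _ t).
    by apply: contraFF nt => /eqP /near_eq ->; case: o; rewrite ?nearl ?nearr.
  rewrite !farE; case: [forall t, _] => //= .
  set n1 := count _ s; set n2 := count _ s; move: n1 n2 => n1 n2.
  by case: (lab x _) (lab y _) (lab y _) => [] [] []; case: n1 n2 => [|[|n1]] [|[|n2]].
have m := merge_edge (o := true) ca ac; have := m; rewrite -{1}yb -{1}xa => m'.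
rewrite big_seq1 (edge_coef_merge m') xa; congr (_%:R); congr nat_of_bool.
rewrite !sx -(count_near m); apply/andP/representsP => [[/forallP far /eqP np] t|sy].
  have [nt|nt] := boolP (near (S a) (c, true) (c, false) t).
    have /eqP eqt : S (c |: a) t == S (c |: a) (c, true) by rewrite -(nearE m).
    by rewrite eqt (lab_eq (u := (c, true))) ?yb.
  by have := far t; rewrite nt (count_far m) // -sx => /eqP ->.
split; last by rewrite sy.
apply/forallP => t; apply/implyP => nt.
have := sy t; rewrite (count_far m) // -sx.
by do 2!case: (lab _ t).
Qed.

(** Vanishing products must have vanishing images. A merge keeps a repeated cycle repeated; after a
    split the two letters may lie on different new cycles, but each term of Delta then repeats one
    of them. *)
Lemma represents_lift a c s (w : seq T) y : c \notin a -> gen_state y = c |: a ->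
    w \in edge_words a c s -> represents (c |: a) w y ->
  exists2 x, gen_state x = a & represents a s x.
Proof.
move=> ca yb w_s /representsP wy; apply: represents_ex => t; move: w_s.
have le1 u : (count (fun v => S (c |: a) u == S (c |: a) v) w <= 1)%N.
  by rewrite -wy; case: (lab y u).
rewrite /edge_words; case: ifPn => ac.
  have m := split_edge (o := true) ca ac.
  have [nt|nt] := boolP (near (S (c |: a)) (c, true) (c, false) t); last first.
    rewrite (count_far m) // => w_s; apply: leq_trans (le1 t).
    by move: w_s; rewrite !inE => /orP[] /eqP->; rewrite /= leq_addl.
  have -> : S a t = S a (c, true) by apply/eqP; rewrite -(nearE m).
  rewrite (count_near m) /= => w_s.
  have := le1 (c, true); have := le1 (c, false).
  by move: w_s; rewrite !inE => /orP[] /eqP-> /=; rewrite eqxx; lia.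
have m := merge_edge (o := true) ca ac; rewrite inE => /eqP ws; rewrite -ws.
apply: leq_trans (le1 t).
by apply: sub_count => u /= /eqP /(merged_fine m) ->.
Qed.

Lemma sum_represents a c s y : c \notin a -> gen_state y = c |: a ->
  \sum_(x | gen_state x == a) (represents a s x)%:R * edge_coef x y
  = \sum_(w <- edge_words a c s) (represents (c |: a) w y)%:R.
Proof.
move=> ca yb; have [/existsP[x /andP[/eqP xa sx]]|/existsPn nox] :=
  boolP [exists x, (gen_state x == a) && represents a s x].
  rewrite (bigD1 x) ?xa //= sx mul1r big1 ?addr0 => [|x' /andP[/eqP xa' neq]].
    exact: represents_edge.
  case sx': (represents a s x'); last by rewrite mul0r.
  by case/eqP: neq; apply: (@represents_uniq s); rewrite ?xa ?xa'.
rewrite big1 => [|x /eqP xa]; last first.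
  by have := nox x; rewrite xa eqxx /= => /negPf->; rewrite mul0r.
rewrite big_seq big1 // => w w_s; case wy: (represents _ w y) => //.
have [x xa sx] := represents_lift ca yb w_s wy.
by have := nox x; rewrite xa eqxx sx.
Qed.

Lemma sum_edge2 a c c' s x z : c \notin a -> c' \notin c |: a ->
    gen_state x = a -> represents a s x -> gen_state z = c' |: (c |: a) ->
  \sum_(y | gen_state y == c |: a) edge_coef x y * edge_coef y z =
  \sum_(w <- edge_words a c s) \sum_(v <- edge_words (c |: a) c' w)
     (represents (c' |: (c |: a)) v z)%:R.
Proof.
move=> ca ca' xa sx zb.
under [RHS]eq_bigr do rewrite -sum_represents //.
rewrite exchange_big /=; apply: eq_bigr => y /eqP yb.
by rewrite (represents_edge ca xa yb sx) mulr_suml.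
Qed.

Lemma eq_represents a s (w : seq T) x :
    (forall t, count (fun u => S a t == S a u) s = count (fun u => S a t == S a u) w) ->
  represents a s x = represents a w x.
Proof. by move=> eqsw; apply: eq_forallb => t; rewrite eqsw. Qed.

Lemma eq_represents_hd a t u s x : S a t = S a u ->
  represents a (t :: s) x = represents a (u :: s) x.
Proof. by move=> tu; apply: eq_represents => v /=; rewrite tu. Qed.

Lemma represents_swap a t u s x :
  represents a (t :: u :: s) x = represents a (u :: t :: s) x.
Proof. by apply: eq_represents => v /=; rewrite addnCA. Qed.

Lemma card_cycles_edge a c : c \notin a ->
  let b := S a (c, true) == S a (c, false) in
  (#|cycles (c |: a)| + ~~ b = #|cycles a| + b)%N.
Proof.
move=> ca /=; case: (boolP (_ == _)) => ac /=; rewrite ?addn0 ?addn1.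
  exact: card_merged (split_edge (o := true) ca ac).
exact/esym/(card_merged (merge_edge (o := true) ca ac)).
Qed.

(* The words obtained along the two paths differ only if each path merges and *)
(* then splits, or each path splits and then merges; in both cases the two    *)
(* crossings touch the same cycles of the last state.                         *)
Lemma edge_words_comm a c c' s z : c \notin a -> c' \notin a -> c != c' ->
  \sum_(w <- edge_words a c s) \sum_(v <- edge_words (c |: a) c' w)
     (represents (c' |: (c |: a)) v z)%:R =
  \sum_(w <- edge_words a c' s) \sum_(v <- edge_words (c' |: a) c w)
     (represents (c |: (c' |: a)) v z)%:R :> rat.
Proof.
move=> ca c'a ncc'.
have ca' : c \notin c' |: a by rewrite !inE negb_or ncc'.
have c'a' : c' \notin c |: a by rewrite !inE negb_or eq_sym ncc'.
rewrite [c' |: (c |: a)]setUCA /edge_words.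
have := card_cycles_edge ca; have := card_cycles_edge c'a.
have := card_cycles_edge ca'; have := card_cycles_edge c'a'.
rewrite [c' |: (c |: a)]setUCA; set b := c |: (c' |: a).
(* Both paths end at the same state, so they contain equally many splits; this leaves six cases. *)
have aux (e1 e2 e3 e4 : bool) (n0 n1 n2 n3 : nat) :
    (n3 + ~~ e2 = n1 + e2 -> n3 + ~~ e3 = n2 + e3 -> n2 + ~~ e4 = n0 + e4 ->
     n1 + ~~ e1 = n0 + e1 -> e1 + e2 = e3 + e4)%N.
  by case: e1 e2 e3 e4 => [] [] [] [] /=; clear; lia.
move=> k1 k2 k3 k4; have {aux k1 k2 k3 k4} := aux _ _ _ _ _ _ _ _ k1 k2 k3 k4.
case: (boolP (S (c |: a) (c', true) == S (c |: a) (c', false))) => s2;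
case: (boolP (S (c' |: a) (c, true) == S (c' |: a) (c, false))) => s3;
case: (boolP (S a (c', true) == S a (c', false))) => s4;
case: (boolP (S a (c, true) == S a (c, false))) => s1 //.
- move=> _; rewrite !(big_cons, big_nil) !addr0.
  rewrite ![represents b [:: (c', _), _ & _] z]represents_swap.
  by rewrite !addrA; congr (_ + _); rewrite addrAC.
- move=> _; rewrite !(big_cons, big_nil) !addr0.
  have m1 := merge_edge (o := true) ca s1.
  have m3 := split_edge (o := true) c'a' s2; rewrite setUCA -/b in m3.
  have m4 := split_edge (o := true) ca' s3; rewrite -/b in m4.
  (* If c' missed the cycles joined at c, it would still merge two cycles afterwards, contrary to
     [s2]. *)
  have nq : near (S a) (c, true) (c, false) (c', true).
    apply: contraT => nq; have := s2; rewrite (merged_far m1) //.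
    by rewrite (negPf s4).
  have nb o : near (S b) (c', true) (c', false) (c, o).
    rewrite (nearE m3) eq_sym (merged_near m1) //.
    by case: o; [apply: nearl | apply: nearr].
  have neq := merged_neq m4.
  case/orP: (nb true) (nb false) neq => /eqP pE /orP[] /eqP pE'; rewrite pE pE' ?eqxx // => _.
    by rewrite !(eq_represents_hd _ _ pE, eq_represents_hd _ _ pE').
  by rewrite addrC !(eq_represents_hd _ _ pE, eq_represents_hd _ _ pE').
- by rewrite !(big_cons, big_nil) !addr0.
- by rewrite !(big_cons, big_nil) !addr0.
- move=> _; rewrite !(big_cons, big_nil) !addr0.
  have m1 := split_edge (o := true) ca s1.
  have m3 := merge_edge (o := true) c'a' s2; rewrite setUCA -/b in m3.
  have m4 := merge_edge (o := true) ca' s3; rewrite -/b in m4.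
  have nq : near (S (c |: a)) (c, true) (c, false) (c', true).
    apply: contraT => nq; have := s4; rewrite (merged_far m1) //.
    by rewrite (negPf s2).
  have eqb o : S b (c', o) = S b (c, true).
    have -> : S b (c', o) = S b (c', true) by case: o; rewrite ?(merged_eq m3).
    by case/orP: nq => /eqP /(merged_fine m3) ->; rewrite ?(merged_eq m4).
  rewrite -(eq_represents_hd _ _ (merged_eq m4)).
  by rewrite !(eq_represents_hd _ _ (eqb _)).
Qed.

Lemma edge_sign_add a c c' : c \notin a -> c' \notin a -> c != c' ->
  edge_sign a c * edge_sign (c |: a) c' = - (edge_sign a c' * edge_sign (c' |: a) c).
Proof.
have signE (b : state D) (i j : C) : i \notin b ->
    edge_sign (i |: b) j = (-1) ^+ (enum_rank i < enum_rank j)%N * edge_sign b j.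
  move=> ib; rewrite /edge_sign -exprD; congr (_ ^+ _).
  rewrite (cardsD1 i) !inE eqxx /=; congr (_ + _)%N; apply: eq_card => u; rewrite !inE.
  by case: eqP => //= ->; rewrite (negPf ib).
move=> ca c'a neq; rewrite !signE //.
have : (enum_rank c : nat) != enum_rank c' by rewrite val_eqE (inj_eq enum_rank_inj).
by case: ltngtP => // _ _; rewrite ?expr0 ?expr1 ?mulN1r ?mul1r ?mulrN ?opprK mulrC.
Qed.

Lemma diff_coef_neq0 x y : diff_coef x y != 0 ->
  exists c, [/\ c \notin gen_state x, gen_state y = c |: gen_state x & edge_coef x y != 0].
Proof.
move=> nz; have /existsP[c /andP[/andP[ca /eqP yE] nzc]] : [exists c,
    ((c \notin gen_state x) && (gen_state y == c |: gen_state x)) && (edge_coef x y != 0)].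
  apply: contraR nz => /existsPn none; rewrite /diff_coef big1 // => c ca.
  by have := none c; rewrite ca /= negbK => /eqP ->; rewrite mulr0.
by exists c.
Qed.

Lemma diff_coefE x y c : c \notin gen_state x -> gen_state y = c |: gen_state x ->
  diff_coef x y = edge_sign (gen_state x) c * edge_coef x y.
Proof.
move=> ca yE; rewrite /diff_coef (bigD1 c) ?ca ?yE ?eqxx //= big1 ?addr0 //.
move=> c' /andP[/andP[c'a /eqP/setP /(_ c')]]; rewrite !inE eqxx (negPf c'a) orbF.
by move=> /= ->.
Qed.

Lemma edge_sign_neq0 a c : edge_sign a c != 0.
Proof. by rewrite expf_neq0 // oppr_eq0 oner_eq0. Qed.

(** The contribution of an ordered pair of crossings is antisymmetric: the edge maps commute
    ([edge_words_comm]) and the signs anticommute ([edge_sign_add]). So the sum is its own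
    opposite. *)
Lemma diff_coef_square x z : \sum_y diff_coef x y * diff_coef y z = 0.
Proof.
set a := gen_state x; have [s sx] := word_ex x.
pose F c c' := if [&& c \notin a, c' \notin c |: a & gen_state z == c' |: (c |: a)]
  then edge_sign a c * edge_sign (c |: a) c' *
    \sum_(y | gen_state y == c |: a) edge_coef x y * edge_coef y z else 0.
have -> : \sum_y diff_coef x y * diff_coef y z = \sum_c \sum_c' F c c'.
  pose G x' c y := if (c \notin gen_state x') && (gen_state y == c |: gen_state x')
    then edge_sign (gen_state x') c * edge_coef x' y else 0.
  have dE x' y : diff_coef x' y = \sum_c G x' c y by rewrite /diff_coef big_mkcond.
  transitivity (\sum_y \sum_c \sum_c' G x c y * G y c' z).
    by apply: eq_bigr => y _; rewrite !dE big_distrlr.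
  rewrite exchange_big; apply: eq_bigr => c _; rewrite exchange_big; apply: eq_bigr => c' _.
  rewrite /F /G; case: ifPn => [/and3P[ca ca' /eqP zE]|ncond].
    rewrite big_distrr [RHS]big_mkcond; apply: eq_bigr => y _ /=; rewrite -/a ca /=.
    by case: eqP => [->|_]; rewrite ?mul0r // ca' zE eqxx mulrACA.
  rewrite big1 // => y _; case: andP => [[ca /eqP yE]|_]; last by rewrite mul0r.
  by move: ncond; rewrite ca yE /= => /negPf->; rewrite mulr0.
have FN c c' : F c c' = - F c' c.
  have condE : [&& c \notin a, c' \notin c |: a & gen_state z == c' |: (c |: a)] =
      [&& c' \notin a, c \notin c' |: a & gen_state z == c |: (c' |: a)].
    by rewrite setUCA !inE !negb_or (eq_sym c'); case: (c \in a) (c' \in a) (c == c') => [] [] [].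
  rewrite /F -condE; case: ifP => [/and3P[ca ca' /eqP zE]|_]; last by rewrite oppr0.
  have [nc c'a] : c != c' /\ c' \notin a.
    by move: ca'; rewrite !inE negb_or eq_sym => /andP[].
  have ca'' : c \notin c' |: a by rewrite !inE negb_or nc.
  have zE' : gen_state z = c |: (c' |: a) by rewrite zE setUCA.
  rewrite (sum_edge2 ca ca' (erefl _) sx zE) (sum_edge2 c'a ca'' (erefl _) sx zE').
  by rewrite (edge_words_comm _ _ ca c'a nc) (edge_sign_add ca c'a nc) mulNr.
have: \sum_c \sum_c' F c c' = - \sum_c \sum_c' F c c'.
  rewrite [in RHS]exchange_big /= -sumrN; apply: eq_bigr => c _.
  by rewrite -sumrN; apply: eq_bigr => c' _.
by move/eqP; rewrite -addr_eq0 -mulr2n mulrn_eq0 => /eqP.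
Qed.

(** * Subcubes with marked points *)

Implicit Types (A F : {set C}) (M : seq (T * bool)).

(* The crossings in F are left unresolved, and those in A are 1-smoothed. *)
Definition linked A F : rel T :=
  [rel t u | (S A t == S A u) || (t.1 \in F) && (t.1 == u.1)].

Lemma linkedE A F t u :
  linked A F t u = (S A t == S A u) || (t.1 \in F) && (t.1 == u.1).
Proof. by []. Qed.

Local Notation cl A F := (class (linked A F)).

Lemma linked_sym A F : connect_sym (linked A F).
Proof.
apply: sym_connect_sym => t u; rewrite !linkedE (eq_sym (S A t)) (eq_sym t.1).
by case: (u.1 =P t.1) => [->|]; rewrite ?andbF.
Qed.

Lemma cl_smoothing A F t u : S A t = S A u -> cl A F t = cl A F u.
Proof.
by move=> tu; apply/eqP; rewrite class_eq; [rewrite connect1 // linkedE tu eqxx | apply: linked_sym].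
Qed.

Lemma cl_set0 A t u : (cl A set0 t == cl A set0 u) = (S A t == S A u).
Proof.
apply/idP/idP => [|/eqP /(cl_smoothing set0) -> //].
rewrite class_eq; last exact: linked_sym.
move=> tu; apply/eqP; apply: class_invariant tu => v w.
by rewrite linkedE inE orbF => /eqP.
Qed.

Lemma cl_crossing A F c o o' : c \in F -> cl A F (c, o) = cl A F (c, o').
Proof.
move=> cF; apply/eqP; rewrite class_eq; last exact: linked_sym.
by rewrite connect1 // linkedE cF eqxx orbT.
Qed.

Lemma pair_or (c : C) o o' : (c, o') = (c, o) \/ (c, o') = (c, ~~ o).
Proof. by case: o o' => [] []; [left | right | right | left]. Qed.

Lemma cl_join0 A F c o t u : c \in F -> let f := cl A (F :\ c) in
  (cl A F t == cl A F u) =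
  (f t == f u) || near f (c, o) (c, ~~ o) t && near f (c, o) (c, ~~ o) u.
Proof.
move=> cF; apply: class_join; try exact: linked_sym.
- move=> v w; rewrite linkedE !inE => /orP[vw|/andP[/andP[_ vF] vw]];
  by rewrite connect1 // linkedE ?vw ?vF ?orbT.
- by rewrite -class_eq; [rewrite (cl_crossing _ _ o) | apply: linked_sym].
move=> [c1 o1] [c2 o2]; rewrite linkedE /= => /orP[/eqP vw|/andP[c1F /eqP <-]].
  by left; apply: cl_smoothing.
have [->|c1c] := eqVneq c1 c.
  right; split; rewrite /near.
    by case: (pair_or c o o1) => ->; rewrite eqxx ?orbT.
  by case: (pair_or c o o2) => ->; rewrite eqxx ?orbT.
by left; apply: cl_crossing; rewrite !inE c1c.
Qed.

Lemma cl_join1 A F c o t u : c \in F -> c \notin A -> let f := cl (c |: A) (F :\ c) in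
  (cl A F t == cl A F u) =
  (f t == f u) || near f (c, o) (c, ~~ o) t && near f (c, o) (c, ~~ o) u.
Proof.
move=> cF cA; apply: class_join; try exact: linked_sym.
- move=> v w; rewrite linkedE => vw; rewrite -class_eq; last exact: linked_sym.
  have nearP v' : near (S A) (c, o) (c, ~~ o) v' -> cl A F v' = cl A F (c, o).
    by case/orP => /eqP /(cl_smoothing F) ->; rewrite // (cl_crossing _ _ o).
  case/orP: vw => [vw|]; last first.
    rewrite !inE => /andP[/andP[_ vF] /eqP vw].
    by case: v w vF vw => [c1 o1] [c2 o2] /= c1F <-; rewrite (cl_crossing _ _ o2).
  have [m|m] := edge_cases o cA; last by rewrite (cl_smoothing F (merged_fine m (eqP vw))).
  move: vw; rewrite (m.2) => /orP[/eqP /(cl_smoothing F) -> //|].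
  by move=> /andP[/nearP-> /nearP->].
- by rewrite -class_eq; [rewrite (cl_crossing _ _ o) | apply: linked_sym].
move=> [c1 o1] [c2 o2]; rewrite linkedE /= => /orP[vw|/andP[c1F /eqP <-]].
  have [m|m] := edge_cases o cA.
    by left; apply/cl_smoothing/(merged_fine m)/eqP.
  move: vw; rewrite (m.2) => /orP[/eqP /cl_smoothing -> //|]; first by left.
  case/andP => n1 n2; right; split; rewrite /near.
    by case/orP: n1 => /eqP /cl_smoothing ->; rewrite eqxx ?orbT.
  by case/orP: n2 => /eqP /cl_smoothing ->; rewrite eqxx ?orbT.
have [->|c1c] := eqVneq c1 c.
  right; split; rewrite /near.
    by case: (pair_or c o o1) => ->; rewrite eqxx ?orbT.
  by case: (pair_or c o o2) => ->; rewrite eqxx ?orbT.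
by left; apply: cl_crossing; rewrite !inE c1c.
Qed.

(** Moving a crossing from [F] to [A] only refines the components ([cl_join1]); once all of
    [a :\: A] is moved, the cycles of [a] are those of the base state. *)
Lemma cl_state A F a t u : A \subset a -> a \subset A :|: F ->
  S a t = S a u -> cl A F t = cl A F u.
Proof.
have [n] := ubnP #|a :\: A|; elim: n A F => // n IHn A F len Aa aAF tu.
have [a0|[c]] := set_0Vmem (a :\: A).
  have aA : a = A by apply/eqP; rewrite eqEsubset Aa andbT -setD_eq0 a0.
  by apply: cl_smoothing; rewrite -aA.
rewrite inE => /andP[cA ca].
have cF : c \in F by have := subsetP aAF c ca; rewrite inE (negPf cA).
apply/eqP; rewrite (cl_join1 true _ _ cF cA); apply/orP; left; apply/eqP; apply: IHn tu.
- rewrite ltnS in len; apply: leq_trans len; apply: proper_card; apply/properP; split.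
    by apply: setDS; apply: subsetUr.
  by exists c; rewrite !inE ?eqxx ?cA.
- by rewrite subUset sub1set ca.
apply: subset_trans aAF _; apply/subsetP => v; rewrite !inE.
by case: eqP => //= _ /orP[] ->; rewrite ?orbT.
Qed.

(* The first unresolved crossing met from t. *)
Lemma next_crossing A F t c0 o0 : c0 \in F -> cl A F t = cl A F (c0, o0) ->
  exists c o, c \in F /\
    forall a, A \subset a -> a \subset A :|: F -> S a t = S a (c, o).
Proof.
move=> c0F tc0; have [/exists_inP[u0 /porbitP[n0 u0E] u0F]|/exists_inPn noF] :=
  boolP [exists u in S A t, u.1 \in F].
  have exF : exists n, ((cycle_perm A ^+ n)%g t).1 \in F by exists n0; rewrite -u0E.
  case: (ex_minnP exF) => n nF minn; set u := fun_of_perm (_ ^+ n)%g t in nF.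
  exists u.1, u.2; split=> // a Aa aAF; rewrite -surjective_pairing.
  (* Before its n-th point the walk only passes crossings outside [F], which are smoothed alike in
     all states of the subcube. *)
  have iterE i : (i <= n)%N -> (cycle_perm a ^+ i)%g t = (cycle_perm A ^+ i)%g t.
    elim: i => [|i IHi] lein //; rewrite !expgSr !permM IHi ?(ltnW lein) // !permE.
    have iF : ((cycle_perm A ^+ i)%g t).1 \notin F.
      by apply: contraL lein => /minn; rewrite -leqNgt.
    rewrite /step !mate_over; set v := fun_of_perm (_ ^+ i)%g t in iF *.
    suff -> : (v.1 \in a) = (v.1 \in A) by [].
    apply/idP/idP => [/(subsetP aAF)|/(subsetP Aa) //].
    by rewrite inE (negPf iF) orbF.
  by rewrite /u -iterE // porbit_perm.
(* A cycle that misses [F] is a whole component, so it would have to contain the crossing c0 of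
   [F]. *)
have: S A t = S A (c0, o0).
  apply/eqP; move/eqP: tc0; rewrite class_eq; last exact: linked_sym.
  case/connectP => s + ->; elim/last_ind: s => [|s u IHs] //=.
  rewrite rcons_path last_rcons linkedE => /andP[/IHs /eqP tE] /orP[/eqP <-|/andP[lF _]].
    by rewrite tE.
  have: last t s \in S A t by rewrite tE porbit_id.
  by move/noF; rewrite lF.
move=> /eqP; rewrite eq_sym eq_porbit_mem => /noF.
by rewrite c0F.
Qed.

(** * Transporting labels across a merge or a split *)

Section Relabel.

Variables (p q : T) (l : bool).

(* The labels of z (with p and q on distinct cycles) and w (with these cycles *)
(* joined) agree, the joined cycle having the label of the cycle of p.        *)
Definition same_labels z w :=
  [forall t, ~~ near (S (gen_state z)) p q t ==> (lab z t == lab w t)] && (lab z p == lab w p).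

Definition join_labels b z :=
  mkgen b (fun t => if near (S (gen_state z)) p q t then lab z p else lab z t).

Definition split_labels a w := mkgen a (fun t => if S a t == S a q then l else lab w t).

Lemma lab_join b z : merged (S (gen_state z)) (S b) p q ->
  lab (join_labels b z) =1 fun t => if near (S (gen_state z)) p q t then lab z p else lab z t.
Proof.
move=> m; apply: lab_mkgen => t u /eqP; rewrite m.2 => /orP[/eqP tu|/andP[-> ->] //].
by rewrite (near_eq _ _ tu) (lab_eq tu).
Qed.

Lemma lab_split a w : merged (S a) (S (gen_state w)) p q ->
  lab (split_labels a w) =1 fun t => if S a t == S a q then l else lab w t.
Proof. by move=> m; apply: lab_mkgen => t u tu; rewrite tu (lab_eq (merged_fine m tu)). Qed.

Lemma same_labels_join b z : merged (S (gen_state z)) (S b) p q ->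
  same_labels z (join_labels b z).
Proof.
move=> m; rewrite /same_labels lab_join // nearl eqxx andbT.
by apply/forallP => t; apply/implyP => /negPf nt; rewrite lab_join // nt.
Qed.

Lemma same_labels_split a w : merged (S a) (S (gen_state w)) p q ->
  same_labels (split_labels a w) w.
Proof.
move=> m; rewrite /same_labels lab_split // (negPf (merged_neq m)) eqxx andbT.
apply/forallP => t; apply/implyP => nt; rewrite lab_split //.
by rewrite ifN //; apply: contraNneq nt => /near_eq->; rewrite nearr.
Qed.

Lemma lab_split_q a w : merged (S a) (S (gen_state w)) p q ->
  lab (split_labels a w) q = l.
Proof. by move=> m; rewrite lab_split // eqxx. Qed.

Lemma same_labels_lab z w t : merged (S (gen_state z)) (S (gen_state w)) p q ->
  same_labels z w -> S (gen_state z) t != S (gen_state z) q -> lab z t = lab w t.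
Proof.
move=> m /andP[/forallP /(_ t) far /eqP eqp] ntq.
have [nt|nt] := boolP (near (S (gen_state z)) p q t); last first.
  by move: far; rewrite nt => /eqP.
move: (nt); rewrite /near (negPf ntq) orbF => /eqP tp.
by rewrite (lab_eq tp) eqp; apply/lab_eq/esym/(merged_fine m).
Qed.

Lemma same_labels_uniq z w : merged (S (gen_state z)) (S (gen_state w)) p q ->
    same_labels z w -> lab z q = l ->
  w = join_labels (gen_state w) z /\ z = split_labels (gen_state z) w.
Proof.
move=> m zw zq; split; apply: gen_eqP => // t; [rewrite lab_join //|rewrite lab_split //].
  case: ifP => nt; last first.
    by have /andP[/forallP /(_ t)] := zw; rewrite nt => /eqP->.
  have [_ /eqP->] := andP zw; apply: lab_eq; apply/eqP.
  by rewrite -(nearE m).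
by case: eqP => [/lab_eq-> //|/eqP ntq]; apply: same_labels_lab.
Qed.

End Relabel.

(** This is m(v 1) = v. *)
Lemma edge_coef_merge0 x y p q : merged (S (gen_state x)) (S (gen_state y)) p q ->
  lab x q = false -> (edge_coef x y != 0) = same_labels p q x y.
Proof.
move=> m xq; rewrite (edge_coef_merge m) xq pnatr_eq0 eqb0 negbK addn0 /same_labels.
by case: (lab x p) (lab y p) => [] [].
Qed.

(** The terms of Delta(v) with X on the second cycle add up to v X. *)
Lemma edge_coef_split1 x y p q : merged (S (gen_state y)) (S (gen_state x)) p q ->
  lab y q -> (edge_coef x y != 0) = same_labels p q y x.
Proof.
move=> m yq; rewrite (edge_coef_split m) yq pnatr_eq0 eqb0 negbK addn1 eqSS /same_labels.
under eq_forallb do rewrite eq_sym.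
by case: (lab x p) (lab y p) => [] [].
Qed.

(** For basis elements v, the product v X never contains v. *)
Lemma edge_coef_merge1 x y p q : merged (S (gen_state x)) (S (gen_state y)) p q ->
  lab x q -> lab x p = lab y p -> edge_coef x y = 0.
Proof.
move=> m xq xyp; rewrite (edge_coef_merge m) xq xyp.
by case: (lab y p); rewrite andbF.
Qed.

(** For basis elements v, Delta(v) never contains v 1. *)
Lemma edge_coef_split0 x y p q : merged (S (gen_state y)) (S (gen_state x)) p q ->
  lab y q = false -> lab x p = lab y p -> edge_coef x y = 0.
Proof.
move=> m yq xyp; rewrite (edge_coef_split m) yq xyp.
by case: (lab y p); rewrite andbF.
Qed.

Definition marked M x := all (fun m => lab x m.1 == m.2) M.

(* The states between A and A :|: F; each mark in M prescribes a label. *)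
Definition subcube A F M : {set generator D} :=
  [set x | [&& A \subset gen_state x, gen_state x \subset A :|: F & marked M x]].

Local Notation exact A F M := (exact_at (@diff_coef D) diagonal (subcube A F M)).

Definition one_mark_each A F M :=
  forall u, count (fun t => cl A F u == cl A F t) (unzip1 M) = 1%N.

Lemma diff_homogeneous : homogeneous (@diff_coef D) diagonal.
Proof.
move=> x y /diff_coef_neq0[c [ca yb nz]].
exact: edge_coef_diagonal ca yb nz.
Qed.

Lemma diff_lab x y t : diff_coef x y != 0 -> lab x t -> lab y t.
Proof. by case/diff_coef_neq0 => c [ca yb nz]; exact: (edge_coef_lab ca yb nz). Qed.

Lemma diff_state x y : diff_coef x y != 0 -> gen_state x \subset gen_state y.
Proof. by case/diff_coef_neq0 => c [ca -> nz]; apply: subsetUr. Qed.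

Lemma diff_edge x y c : diff_coef x y != 0 -> c \notin gen_state x -> c \in gen_state y ->
  gen_state y = c |: gen_state x /\ edge_coef x y != 0.
Proof.
case/diff_coef_neq0 => c' [ca -> nz] cx; rewrite !inE (negPf cx) orbF => /eqP->.
by [].
Qed.

(** States and labels X only grow along the differential, so whatever lies between two generators of
    a subcube is in it: subcubes are subquotients of the full complex. *)
Lemma subcube_square_zero A F M : square_zero (@diff_coef D) (subcube A F M).
Proof.
move=> x z; rewrite !inE => /and3P[Ax _ /allP Mx] /and3P[_ zF /allP Mz].
rewrite -[RHS](diff_coef_square x z) [RHS](bigID [in subcube A F M]) /=.
rewrite [X in _ = _ + X]big1 ?addr0 // => y; apply: contraNeq.
rewrite mulf_eq0 => /norP[xy yz]; rewrite inE (subset_trans Ax (diff_state xy)).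
rewrite (subset_trans (diff_state yz) zF) /=; apply/allP => m mM.
have /eqP := Mx m mM; have /eqP := Mz m mM; case: (m.2) => [_ /(diff_lab xy) -> //|mz _].
rewrite eqbF_neg; by apply: contraFN mz => /(diff_lab yz).
Qed.

Lemma subcube_split A F M c : c \in F -> c \notin A ->
  subcube A F M = subcube (c |: A) (F :\ c) M :|: subcube A (F :\ c) M.
Proof.
move=> cF cA; apply/setP => x; rewrite !inE; case: (marked M x); rewrite ?andbF // !andbT.
have AFE : (c |: A) :|: F :\ c = A :|: F.
  by apply/setP => v; rewrite !inE; case: eqP => [->|]; rewrite ?cF ?orbT.
rewrite AFE subUset sub1set; have [cx|cx] := boolP (c \in gen_state x) => /=.
  rewrite [X in _ || X](_ : _ = false) ?orbF //.
  apply/negP => /andP[_ /subsetP /(_ c cx)].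
  by rewrite !inE eqxx (negPf cA).
congr (_ && _); apply/subsetP/subsetP => sub v vx; have := sub v vx; rewrite !inE.
  have -> : v != c by apply: contraNneq cx => <-.
  by [].
by case/orP => [->|/andP[_ ->]]; rewrite ?orbT.
Qed.

Lemma subcube_crossing0 A F M c x : c \notin A -> x \in subcube A (F :\ c) M ->
  c \notin gen_state x.
Proof.
move=> cA; rewrite inE => /and3P[_ /subsetP sub _].
by apply/negP => /sub; rewrite !inE eqxx (negPf cA).
Qed.

Lemma subcube_crossing1 A F M c x : x \in subcube (c |: A) F M -> c \in gen_state x.
Proof. by rewrite inE subUset sub1set => /andP[/andP[-> _] _]. Qed.

Lemma subcube_label A F M t : subcube A F M =
  subcube A F ((t, true) :: M) :|: subcube A F ((t, false) :: M).
Proof.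
apply/setP => x; rewrite !inE /marked /=.
by case: (lab x t) => /=; rewrite ?andbF ?orbF.
Qed.

(** The only mark of the joined class lies on the side of p, so the side of q has none and receives
    q. *)
Lemma marks_split (U V : eqType) (f : T -> U) (g : T -> V) p q t (s : seq T) :
    merged f g p q -> (forall u, count (fun v => g u == g v) s = 1%N) ->
    t \in s -> f t = f p ->
  (forall u, count (fun v => f u == f v) (q :: s) = 1%N) /\
  (forall u, u \in s -> f u != f q).
Proof.
move=> m one ts tp.
have p1 : (0 < count (fun v => f p == f v) s)%N.
  by rewrite -has_count; apply/hasP; exists t; rewrite // tp.
have := one p; rewrite (count_near m) => pq1.
have q0 : count (fun v => f q == f v) s = 0%N.
  by case: (count _ s) (count _ s) p1 pq1 => [|n1] [|n2] //; rewrite ?addnS.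
have {}p1 : count (fun v => f p == f v) s = 1%N by rewrite -pq1 q0 addn0.
split=> u /=; last first.
  move=> us; apply: contraTneq (eqxx (f q)) => uq; move/eqP: q0.
  by rewrite -leqn0 leqNgt -has_count => /hasPn /(_ u us); rewrite uq.
have [/orP[] /eqP uE|nu] := boolP (near f p q u).
- by rewrite !uE (negPf (merged_neq m)) p1.
- by rewrite uE eqxx q0.
rewrite -(count_far m) // one; suff /negPf-> : f u != f q by [].
by apply: contraNneq nu => /near_eq->; apply: nearr.
Qed.

(** * Removing a crossing next to a mark *)

Section NextToMark.

Variables (A F : {set C}) (M : seq (T * bool)) (c : C) (o : bool) (m : T * bool) (n : int).
Hypotheses (cF : c \in F) (cA : c \notin A) (mM : m \in M).
Hypothesis mE : forall a, A \subset a -> a \subset A :|: F -> S a m.1 = S a (c, o).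
Hypothesis oneM : one_mark_each A F M.

Local Notation p := (c, o).
Local Notation q := (c, ~~ o).
Local Notation F' := (F :\ c).
Local Notation A' := (c |: A).

Lemma subcube0 x M' : x \in subcube A F' M' -> x \in subcube A F M'.
Proof. by move=> xG; rewrite (subcube_split M' cF cA) inE xG orbT. Qed.

Lemma subcube1 x M' : x \in subcube A' F' M' -> x \in subcube A F M'.
Proof. by move=> xG; rewrite (subcube_split M' cF cA) inE xG. Qed.

Lemma subcube_cons B F1 t l M' x :
  (x \in subcube B F1 ((t, l) :: M')) = (x \in subcube B F1 M') && (lab x t == l).
Proof. by rewrite !inE /marked /= !andbA [RHS]andbAC. Qed.

Lemma lab_mark x : x \in subcube A F M -> lab x p = m.2.
Proof.
rewrite inE => /and3P[Ax xF /allP /(_ m mM) /eqP <-].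
exact/lab_eq/esym/mE.
Qed.

Lemma diff_down x y M1 M2 : x \in subcube A' F' M1 -> y \in subcube A F' M2 ->
  diff_coef x y = 0.
Proof.
move=> xG yG; apply/eqP; apply: contraT => /diff_state /subsetP /(_ c).
rewrite (subcube_crossing1 xG) => /(_ isT).
by rewrite (negPf (subcube_crossing0 cA yG)).
Qed.

Lemma subcube_disjoint M1 M2 : [disjoint subcube A' F' M1 & subcube A F' M2].
Proof.
rewrite disjoint_subset; apply/subsetP => x /subcube_crossing1 cx; rewrite inE.
by apply: contraL cx => /(subcube_crossing0 cA).
Qed.

Lemma diff_up x y M1 M2 : x \in subcube A F' M1 -> y \in subcube A' F' M2 ->
  diff_coef x y != 0 -> gen_state y = c |: gen_state x /\ edge_coef x y != 0.
Proof.
by move=> xG yG nz; apply: diff_edge; rewrite ?(subcube_crossing0 cA xG) ?(subcube_crossing1 yG).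
Qed.

Lemma exact_connected : exact A' F' M n -> exact A F' M n -> exact A F M n.
Proof.
rewrite (subcube_split M cF cA) => ex1 ex0.
apply: exact_at_split ex1 ex0; [exact: diff_homogeneous|exact: subcube_disjoint| |].
  by move=> x y; apply: diff_down.
by rewrite -(subcube_split M cF cA); apply: subcube_square_zero.
Qed.

Lemma add_state0 x M' : x \in subcube A F' M' ->
  A' \subset c |: gen_state x /\ c |: gen_state x \subset A' :|: F'.
Proof.
rewrite inE => /and3P[Ax xF _]; split; first exact: setUS.
by rewrite -setUA; apply: setUS.
Qed.

Lemma del_state1 x M' : x \in subcube A' F' M' ->
  A \subset gen_state x :\ c /\ gen_state x :\ c \subset A :|: F'.
Proof.
rewrite inE => /and3P[Ax xF _]; split.
  by rewrite subsetD1 cA andbT; apply: subset_trans Ax; apply: subsetUr.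
by rewrite subDset setUA.
Qed.

Lemma diff_neq0 x y M1 : x \in subcube A F' M1 -> gen_state y = c |: gen_state x ->
  edge_coef x y != 0 -> diff_coef x y != 0.
Proof.
move=> xG yE nz; rewrite (diff_coefE (c := c)) ?(subcube_crossing0 cA xG) //.
by rewrite mulf_neq0 ?edge_sign_neq0.
Qed.

Section Disconnecting0.

Hypothesis dis : cl A F' p != cl A F' q.

Lemma merged_cl0 : merged (cl A F') (cl A F) p q.
Proof. by split=> // t u; apply: cl_join0. Qed.

Lemma marks0 :
  one_mark_each A F' ((q, true) :: M) /\ (forall t, t \in unzip1 M -> cl A F' t != cl A F' q).
Proof.
apply: marks_split merged_cl0 oneM (map_f _ mM) _.
by apply/cl_smoothing/mE; rewrite ?subsetUl.
Qed.

Lemma merged_state0 a : A \subset a -> a \subset A :|: F' ->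
  merged (S a) (S (c |: a)) p q.
Proof.
move=> Aa aF; have ca : c \notin a.
  by apply/negP => /(subsetP aF); rewrite !inE eqxx (negPf cA).
have [//|mab] := edge_cases o ca; case/eqP: dis; apply: cl_state Aa aF _.
apply/eqP; rewrite (_ : S a p = S a q) //.
exact: (merged_eq mab).
Qed.

Lemma marked0 x y : A \subset gen_state x -> gen_state x \subset A :|: F' ->
  merged (S (gen_state x)) (S (gen_state y)) p q -> same_labels p q x y ->
  marked M x = marked M y.
Proof.
move=> Ax xF mxy xy; apply: eq_in_all => m' m'M.
rewrite (same_labels_lab mxy xy) //; apply: contra_neq (marks0.2 m'.1 (map_f _ m'M)).
exact: cl_state.
Qed.

(** All edges at c are merges. The mark fixes the label v of p on both faces, and v X never contains
    v, so the part with X at q is a subcomplex. In the quotient, m(v 1) = v matches the label 1 at q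
    with the whole 1-face. *)
Lemma exact_disconnected0 : exact A F' ((q, true) :: M) n -> exact A F M n.
Proof.
move=> exX; pose G1 := subcube A' F' M; pose Q1 := subcube A F' ((q, false) :: M).
have sq0 := @subcube_square_zero A F M.
have GE : subcube A F M = subcube A F' ((q, true) :: M) :|: (G1 :|: Q1).
  by rewrite (subcube_split M cF cA) (subcube_label A F' M q) setUCA.
have disj : [disjoint subcube A F' ((q, true) :: M) & G1 :|: Q1].
  rewrite disjoint_subset; apply/subsetP => x xX; rewrite inE in_setU negb_or.
  rewrite (disjointFl (subcube_disjoint _ _) xX) /=.
  by move: xX; rewrite !subcube_cons => /andP[_ /eqP->]; rewrite andbF.
have zero x y : x \in subcube A F' ((q, true) :: M) -> y \in G1 :|: Q1 ->
    diff_coef x y = 0.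
  move=> xX yE; apply/eqP; apply: contraT => nz; move: yE; rewrite in_setU => /orP[yG|].
    have [yE nze] := diff_up xX yG nz; have := xX; rewrite subcube_cons.
    move=> /andP[xG /eqP xq]; case/eqP: nze; apply: edge_coef_merge1 xq _.
      by rewrite yE; move: xG; rewrite inE => /and3P[? ? _]; apply: merged_state0.
    by rewrite !lab_mark // ?(subcube0 xG) ?(subcube1 yG).
  rewrite subcube_cons => /andP[_]; move: xX; rewrite subcube_cons => /andP[_ /eqP xq].
  by rewrite (diff_lab nz) ?xq.
rewrite GE in sq0 *; have [_ sqE] := square_zero_split disj zero sq0.
apply: exact_at_split => //; first exact: diff_homogeneous.
have mer x : x \in Q1 -> merged (S (gen_state x)) (S (c |: gen_state x)) p q.
  by rewrite inE => /and3P[? ? _]; apply: merged_state0.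
have mer' y : y \in G1 -> merged (S (gen_state y :\ c)) (S (gen_state y)) p q.
  move=> yG; have [Ay yF] := del_state1 yG.
  by have := merged_state0 Ay yF; rewrite setD1K ?(subcube_crossing1 yG).
apply: (@exact_at_matching _ _ _ _ _ _ (fun x => join_labels p q (c |: gen_state x) x)
  (fun y => split_labels q false (gen_state y :\ c) y)) => //.
- exact: diff_homogeneous.
- exact: subcube_disjoint.
- move=> x xQ; set y := join_labels _ _ _ _.
  have mxy : merged (S (gen_state x)) (S (gen_state y)) p q := mer x xQ.
  have xy : same_labels p q x y := same_labels_join (mer x xQ).
  have [xG /eqP xq] := andP (etrans (esym (subcube_cons _ _ _ _ _ _)) xQ).
  split; last first.
    by apply: diff_neq0 xQ _ _; rewrite // (edge_coef_merge0 mxy xq).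
  have [sub1 sub2] := add_state0 xG; rewrite inE sub1 sub2.
  by move: xG; rewrite inE => /and3P[Ax xF]; rewrite (marked0 Ax xF mxy xy).
- move=> y yG; set x := split_labels _ _ _ _.
  have mxy : merged (S (gen_state x)) (S (gen_state y)) p q := mer' y yG.
  have xy : same_labels p q x y := same_labels_split _ (mer' y yG).
  have xq : lab x q = false := lab_split_q _ (mer' y yG).
  have [Ax xF] := del_state1 yG.
  have xG : x \in subcube A F' M.
    rewrite inE Ax xF (marked0 (x := x) Ax xF mxy xy).
    by move: yG; rewrite inE => /and3P[].
  split; first by rewrite subcube_cons xG xq.
  apply: diff_neq0 xG _ _; last by rewrite (edge_coef_merge0 mxy xq).
  by rewrite setD1K // (subcube_crossing1 yG).
- move=> x y xQ yG nz; have [yE nze] := diff_up xQ yG nz.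
  have := mer x xQ; rewrite -yE => mxy.
  have [xG /eqP xq] := andP (etrans (esym (subcube_cons _ _ _ _ _ _)) xQ).
  have xy : same_labels p q x y by rewrite -(edge_coef_merge0 mxy xq).
  have [ey ex] := same_labels_uniq mxy xy xq.
  by split=> //; rewrite {1}ex yE setU1K ?(subcube_crossing0 cA xG).
Qed.

End Disconnecting0.

Section Disconnecting1.

Hypothesis dis : cl A' F' p != cl A' F' q.

Lemma merged_cl1 : merged (cl A' F') (cl A F) p q.
Proof. by split=> // t u; apply: cl_join1. Qed.

Lemma marks1 :
  one_mark_each A' F' ((q, false) :: M) /\ (forall t, t \in unzip1 M -> cl A' F' t != cl A' F' q).
Proof.
apply: marks_split merged_cl1 oneM (map_f _ mM) _.
apply/cl_smoothing/mE; first exact: subsetUr.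
by rewrite setUC setUS // sub1set.
Qed.

Lemma merged_state1 a : A' \subset a -> a \subset A' :|: F' ->
  merged (S a) (S (a :\ c)) p q.
Proof.
move=> Aa aF; have ca : c \in a by apply: (subsetP Aa); rewrite !inE eqxx.
have nc : c \notin a :\ c by rewrite !inE eqxx.
have := edge_cases o nc; rewrite setD1K //; case=> [mab|//].
by case/eqP: dis; apply: cl_state Aa aF (merged_eq mab).
Qed.

Lemma marked1 x y : A' \subset gen_state y -> gen_state y \subset A' :|: F' ->
  merged (S (gen_state y)) (S (gen_state x)) p q -> same_labels p q y x ->
  marked M x = marked M y.
Proof.
move=> Ay yF mxy xy; apply: eq_in_all => m' m'M.
rewrite -(same_labels_lab mxy xy) //; apply: contra_neq (marks1.2 m'.1 (map_f _ m'M)).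
exact: cl_state.
Qed.

(** Dually, all edges at c are splits. The 0-face and the part of the 1-face with X at q form a
    subcomplex, exact because Delta matches them; the quotient carries the label 1 at q. *)
Lemma exact_disconnected1 : exact A' F' ((q, false) :: M) n -> exact A F M n.
Proof.
move=> exX; pose G0 := subcube A F' M; pose S1 := subcube A' F' ((q, true) :: M).
have sq0 := @subcube_square_zero A F M.
have GE : subcube A F M = (S1 :|: G0) :|: subcube A' F' ((q, false) :: M).
  by rewrite (subcube_split M cF cA) (subcube_label A' F' M q) setUAC.
have disj : [disjoint S1 :|: G0 & subcube A' F' ((q, false) :: M)].
  rewrite disjoint_sym disjoint_subset; apply/subsetP => x xX; rewrite inE in_setU negb_or.
  rewrite (disjointFr (subcube_disjoint _ _) xX) andbT.
  by move: xX; rewrite !subcube_cons => /andP[_ /eqP->]; rewrite andbF.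
have mer x : x \in G0 -> merged (S (c |: gen_state x)) (S (gen_state x)) p q.
  move=> xG; have [Ax xF] := add_state0 xG.
  by have := merged_state1 Ax xF; rewrite setU1K ?(subcube_crossing0 cA xG).
have mer' y : y \in S1 -> merged (S (gen_state y)) (S (gen_state y :\ c)) p q.
  by rewrite inE => /and3P[? ? _]; apply: merged_state1.
have zero x y : x \in S1 :|: G0 -> y \in subcube A' F' ((q, false) :: M) ->
    diff_coef x y = 0.
  move=> xE yX; apply/eqP; apply: contraT => nz; move: xE; rewrite in_setU => /orP[|xG].
    rewrite subcube_cons => /andP[_ /eqP xq]; move: yX; rewrite subcube_cons.
    by rewrite (diff_lab nz) ?xq ?andbF.
  have [yE nze] := diff_up xG yX nz; have := yX; rewrite subcube_cons.
  move=> /andP[yG /eqP yq]; case/eqP: nze; apply: edge_coef_split0 yq _.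
    by rewrite yE; apply: mer.
  by rewrite !lab_mark // ?(subcube0 xG) ?(subcube1 yG).
rewrite GE in sq0 *; have [sqE _] := square_zero_split disj zero sq0.
apply: exact_at_split => //; first exact: diff_homogeneous.
apply: (@exact_at_matching _ _ _ _ _ _ (fun x => split_labels q true (c |: gen_state x) x)
  (fun y => join_labels p q (gen_state y :\ c) y)) => //.
- exact: diff_homogeneous.
- exact: subcube_disjoint.
- move=> x xG; set y := split_labels _ _ _ _.
  have myx : merged (S (gen_state y)) (S (gen_state x)) p q := mer x xG.
  have yx : same_labels p q y x := same_labels_split _ (mer x xG).
  have yq : lab y q = true := lab_split_q _ (mer x xG).
  have [Ay yF] := add_state0 xG; split; last first.
    by apply: diff_neq0 xG _ _; rewrite // (edge_coef_split1 myx yq).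
  rewrite subcube_cons yq eqxx andbT inE Ay yF -(marked1 (y := y) Ay yF myx yx).
  by move: xG; rewrite inE => /and3P[].
- move=> y yS; set x := join_labels _ _ _ _.
  have myx : merged (S (gen_state y)) (S (gen_state x)) p q := mer' y yS.
  have yx : same_labels p q y x := same_labels_join (mer' y yS).
  have [yG /eqP yq] := andP (etrans (esym (subcube_cons _ _ _ _ _ _)) yS).
  have [Ax xF] := del_state1 yG.
  have xG : x \in subcube A F' M.
    rewrite inE Ax xF; move: yG; rewrite inE => /and3P[Ay yF].
    by rewrite (marked1 Ay yF myx yx).
  split=> //; apply: diff_neq0 xG _ _; last by rewrite (edge_coef_split1 myx yq).
  by rewrite setD1K // (subcube_crossing1 yG).
- move=> x y xG yS nz; have [yE nze] := diff_up xG yS nz.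
  have := mer x xG; rewrite -yE => myx.
  have [yG /eqP yq] := andP (etrans (esym (subcube_cons _ _ _ _ _ _)) yS).
  have yx : same_labels p q y x by rewrite -(edge_coef_split1 myx yq).
  have [ex ey] := same_labels_uniq myx yx yq.
  by split=> //; rewrite {1}ex yE setU1K ?(subcube_crossing0 cA xG).
Qed.

End Disconnecting1.

End NextToMark.

Lemma one_mark_cycles A M : one_mark_each A set0 M ->
  uniq (map (cyc A) (unzip1 M)) /\ cycles A =i map (cyc A) (unzip1 M).
Proof.
move=> oneM.
have one t : count (fun u => cyc A u == cyc A t) (unzip1 M) = 1%N.
  rewrite -[RHS](oneM t); apply: eq_count => u.
  by rewrite cl_set0 cyc_eq eq_sym.
split=> [|k].
  apply: count_mem_uniq => k; have [/mapP[t _ ->]|/count_memPn //] := boolP (k \in _).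
  by rewrite count_map -[RHS](one t); apply: eq_count.
apply/cyclesP/mapP => [[t ->]|[t _ ->]]; last by exists t.
have : has (fun u => cyc A u == cyc A t) (unzip1 M) by rewrite has_count one.
by case/hasP => u uM /eqP <-; exists u.
Qed.

(** With no crossing left, components are cycles and the marks determine every label. *)
Lemma diagonal_marked A M x : one_mark_each A set0 M -> gen_state x = A -> marked M x ->
  diagonal x = (2 * count (fun m => ~~ m.2) M)%:Z - #|cycles A|%:Z - #|A|%:Z
  /\ #|cycles A| = size M.
Proof.
move=> oneM xA /allP Mx; have [uM memM] := one_mark_cycles oneM.
have kA : #|cycles A| = size M.
  by rewrite (eq_card memM) (card_uniqP uM) !size_map.
have XE : #|gen_X x| = count (fun m => m.2) M.
  have -> : #|gen_X x| = count [in gen_X x] (map (cyc A) (unzip1 M)).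
    rewrite -size_filter -(card_uniqP (filter_uniq _ uM)); apply: eq_card => k.
    rewrite mem_filter -memM andb_idr // => kX.
    by rewrite -xA; apply: (subsetP (valP x)).
  rewrite !count_map; apply: eq_in_count => m mM /=.
  by have /eqP <- := Mx m mM; rewrite /lab xA.
split=> //; rewrite /diagonal xA XE.
have : (count (fun m => m.2) M + count (fun m => ~~ m.2) M = #|cycles A|)%N.
  by rewrite kA -(count_predC (fun m => m.2) M).
by move: (count _ M) (count _ M) #|cycles A| #|A| => n1 n2 n3 n4; lia.
Qed.

(** The upper bound is the least diagonal over the state [A] (X on all unmarked cycles), the lower
    bound the greatest one over [A :|: F] (1 on all unmarked cycles). They coincide when [F] is
    empty, and the induction never widens them. *)
Theorem exact_subcube A F M n : [disjoint A & F] -> one_mark_each A F M ->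
  ((2 * count (fun m => ~~ m.2) M)%:Z - #|cycles A|%:Z - #|A|%:Z < n)
  || (n < #|cycles (A :|: F)|%:Z - #|A :|: F|%:Z
          + (2 * count (fun m => ~~ m.2) M)%:Z - (2 * size M)%:Z) ->
  exact A F M n.
Proof.
have [k] := ubnP #|F|; elim: k A F M => // k IHk A F M leF disAF oneM bound.
have [F0|[c0 c0F]] := set_0Vmem F.
  apply: exact_at_degree => x; rewrite F0 in oneM bound *.
  rewrite setU0 in bound; rewrite inE setU0 => /and3P[Ax xA Mx].
  have xE : gen_state x = A by apply/eqP; rewrite eqEsubset xA Ax.
  have [-> kA] := diagonal_marked oneM xE Mx; apply: contraTneq bound => <-.
  by rewrite kA; move: (count _ M) (size M) #|A| => n1 n2 n3; lia.
have : has (fun t => cl A F (c0, true) == cl A F t) (unzip1 M) by rewrite has_count oneM.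
case/hasP => t /mapP[m mM ->] /eqP/esym tc0.
have [c [o [cF mE]]] := next_crossing c0F tc0.
have cA : c \notin A by rewrite (disjointFl disAF cF).
have ltF' : (#|F :\ c| < k)%N by move: leF; rewrite (cardsD1 c) cF.
have dis0 : [disjoint A & F :\ c].
  by apply: disjointWr disAF; apply: subD1set.
have dis1 : [disjoint c |: A & F :\ c].
  by rewrite disjoints_subset subUset sub1set -disjoints_subset dis0 !inE eqxx.
have cAF : c \notin A :|: F :\ c by rewrite !inE eqxx (negPf cA).
have AFE : A :|: F = c |: (A :|: F :\ c) by rewrite setUCA setD1K.
have := card_cycles_edge cA; have := card_cycles_edge cAF; rewrite -AFE.
have kAF : #|A :|: F| = #|A :|: F :\ c|.+1 by rewrite AFE cardsU1 cAF.
have kA : #|c |: A| = #|A|.+1 by rewrite cardsU1 cA.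
set b2 := _ == _; set b1 := _ == _ => /= k2 k1.
have AFE1 : (c |: A) :|: F :\ c = A :|: F by rewrite -setUA -AFE.
have bit (b : bool) n1 n2 : (n1 + ~~ b = n2 + b)%N -> n1 = n2.+1 \/ n2 = n1.+1.
  by clear; case: b => /=; rewrite ?addn0 ?addn1 => ->; [left|right].
have [dis|] := boolP (cl A (F :\ c) (c, o) != cl A (F :\ c) (c, ~~ o)).
  apply: (exact_disconnected0 cF cA mM mE oneM dis); apply: IHk => //.
    by have [] := marks0 cF mM mE oneM dis.
  (* The top state gains a cycle and loses a 1-smoothing, which offsets the extra mark labeled X:
     both bounds are unchanged. *)
  have := merged_state0 cA dis (subsetUl A _) (subxx (A :|: F :\ c)).
  rewrite -AFE => /card_merged kE; move: bound; rewrite kAF kE /=.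
  move: #|cycles A| #|cycles (A :|: F)| #|A| #|A :|: F :\ c| (count _ M) (size M).
  by clear; move=> n1 n2 n3 n4 n5 n6; lia.
rewrite negbK => /eqP con0.
have [dis|] := boolP (cl (c |: A) (F :\ c) (c, o) != cl (c |: A) (F :\ c) (c, ~~ o)).
  apply: (exact_disconnected1 cF cA mM mE oneM dis); apply: IHk => //.
    by have [] := marks1 cF cA mM mE oneM dis.
  (* The extra label 1 offsets the additional cycle and 1-smoothing of the bottom state: both bounds
     are unchanged. *)
  have := merged_state1 dis (subxx _) (subsetUl _ _).
  rewrite setU1K // => /card_merged kE; move: bound; rewrite AFE1 kA kE /=.
  move: #|cycles A| #|cycles (A :|: F)| #|A| #|A :|: F| (count _ M) (size M).
  by clear; move=> n1 n2 n3 n4 n5 n6; lia.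
rewrite negbK => /eqP con1.
have nearE (f : T -> {set T}) t1 : f (c, o) = f (c, ~~ o) ->
    near f (c, o) (c, ~~ o) t1 = (f t1 == f (c, o)).
  by rewrite /near => <-; rewrite orbb.
(* The components, hence the marks, are the same on both faces. As an edge changes the number of
   cycles by one, each face keeps one bound and does not weaken the other. *)
apply: (exact_connected cF cA); [apply: (IHk _ _ _ ltF' dis1) | apply: (IHk _ _ _ ltF' dis0)].
- move=> u; rewrite -[RHS](oneM u); apply: eq_count => v.
  rewrite (cl_join1 o _ _ cF cA) /= !nearE // orb_idr //.
  by case/andP => /eqP-> /eqP->.
- rewrite AFE1 kA; have {k1} := bit _ _ _ k1; move: bound.
  move: #|cycles A| #|cycles (c |: A)| #|cycles (A :|: F)| #|A| #|A :|: F| (count _ M) (size M).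
  by clear; move=> n1 n2 n3 n4 n5 n6 n7; lia.
- move=> u; rewrite -[RHS](oneM u); apply: eq_count => v.
  rewrite (cl_join0 A o _ _ cF) /= !nearE // orb_idr //.
  by case/andP => /eqP-> /eqP->.
have {k2} := bit _ _ _ k2; move: bound; rewrite kAF.
move: #|cycles A| #|cycles (A :|: F :\ c)| #|cycles (A :|: F)| #|A| #|A :|: F :\ c| (count _ M) (size M).
by clear; move=> n1 n2 n3 n4 n5 n6 n7; lia.
Qed.

(** The labels X and 1 of a single mark give a subcomplex and a quotient whose ranges differ by a
    shift of 2; hence g + 2 lines instead of g + 1. *)
Lemma exact_total n : (forall t u, cl set0 setT t = cl set0 setT u) -> T ->
  (2 - #|cycles (set0 : state D)|%:Z < n) || (n < #|cycles (setT : state D)|%:Z - #|C|%:Z - 2) ->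
  exact_at (@diff_coef D) diagonal setT n.
Proof.
move=> conn t0 bound.
have one l : one_mark_each set0 setT [:: (t0, l)].
  by move=> u /=; rewrite (conn u t0) eqxx.
have ex l : exact set0 setT [:: (t0, l)] n.
  apply: exact_subcube => //; first by rewrite -setI_eq0 set0I.
  rewrite set0U cards0 cardsT; case: l => /=; move: bound.
    by move: #|cycles _| #|cycles _| #|C|; clear; move=> n1 n2 n3; lia.
  by move: #|cycles _| #|cycles _| #|C|; clear; move=> n1 n2 n3; lia.
have GE : setT = subcube set0 setT [:: (t0, true)] :|: subcube set0 setT [:: (t0, false)].
  rewrite -subcube_label; apply/setP => x.
  by rewrite !inE sub0set set0U subsetT.
rewrite GE; apply: exact_at_split (ex true) (ex false).
- exact: diff_homogeneous.
- rewrite disjoint_subset; apply/subsetP => x; rewrite [in X in _ -> X]inE !subcube_cons.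
  by case/andP => _ /eqP->; rewrite andbF.
- move=> x y; rewrite !subcube_cons => /andP[_ /eqP xt] /andP[_ /eqP yt].
  by apply/eqP; apply: contraFT yt => /diff_lab ->.
by rewrite -GE => x z _ _; rewrite -[RHS](diff_coef_square x z); apply: eq_bigl => y; rewrite inE.
Qed.

(** Along an edge both summands change by one. This parity is why consecutive lines differ by 2. *)
Lemma odd_cycles a : odd (#|cycles a| + #|a|) = odd #|cycles (set0 : state D)|.
Proof.
have [k] := ubnP #|a|; elim: k a => // k IHk a lek.
have [->|[c ca]] := set_0Vmem a; first by rewrite cards0 addn0.
have := cardsD1 c a; rewrite ca add1n => aE.
have <- := IHk (a :\ c) _; last by move: lek; rewrite aE.
have nc : c \notin a :\ c by rewrite !inE eqxx.
have := card_cycles_edge nc; rewrite /= setD1K // aE.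
case: (_ == _) => /=; rewrite ?addn0 ?addn1 => e.
  by rewrite e addSn addnS /= negbK.
by rewrite -e addnS addSn.
Qed.

Lemma odd_diagonal x : exists k : int, diagonal x = #|cycles (set0 : state D)|%:Z - 2 * k.
Proof.
have := odd_cycles (gen_state x); rewrite /diagonal.
move: #|cycles _| #|cycles _| #|gen_X x| #|gen_state x|; clear=> n1 n2 n3 n4 e.
exists ((n1./2)%:Z - ((n2 + n4)./2)%:Z + n3%:Z + n4%:Z); lia.
Qed.

End States.

(** * Khovanov homology *)

Section Homology.

Variable D : diagram.
Implicit Types (x y : generator D) (i j : int).

Lemma quantum_degreeE x :
  quantum_degree x = diagonal x + 2 * hom_degree x + (n_pos D)%:Z.
Proof.
rewrite /quantum_degree /diagonal /hom_degree cardsD.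
have := subset_leq_card (valP x : gen_X x \subset cycles (gen_state x)).
rewrite (setIidPr (valP x : gen_X x \subset cycles (gen_state x))).
move: #|cycles _| #|gen_X x| #|gen_state x| (n_neg D) (n_pos D).
by clear=> n1 n2 n3 n4 n5; lia.
Qed.

Lemma chainsP i j (f : chain D) : reflect
  (forall x, f x != 0 -> (hom_degree x == i) && (quantum_degree x == j))
  (f \in chains D i j).
Proof.
set X := [seq basis_chain x | x <- enum (generator D)
            & (hom_degree x == i) && (quantum_degree x == j)].
apply: (iffP idP) => [fX x|fX].
  apply: contraR => nx; rewrite (coord_span (X := in_tuple X) fX) sum_ffunE.
  rewrite big1 // => k _; rewrite !ffunE.
  have /mapP[y] : X`_k \in X by rewrite mem_nth // ltn_ord.
  rewrite mem_filter => /andP[ydeg _] ->; rewrite ffunE.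
  by rewrite (_ : x == y = false) ?scaler0 //; apply: contraNF nx => /eqP->.
have -> : f = \sum_x f x *: basis_chain x.
  have bE x y : (f x *: basis_chain x) y = f x * (y == x)%:R.
    by rewrite !ffunE.
  apply/ffunP => y; rewrite sum_ffunE; transitivity (\sum_x f x * (y == x)%:R).
    rewrite (bigD1 y isT) eqxx mulr1 big1 => [|x neq].
      exact/esym/addr0.
    by rewrite eq_sym (negPf neq) mulr0.
  by apply: eq_bigr => x _; rewrite bE.
apply: memv_suml => x _; have [->|/fX xdeg] := eqVneq (f x) 0; first by rewrite scale0r mem0v.
apply/memvZ/memv_span/map_f.
by rewrite mem_filter xdeg mem_enum.
Qed.

Lemma Kh_gen i j : Kh D i j != 0%VS ->
  exists x, hom_degree x = i /\ quantum_degree x = j.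
Proof.
rewrite -vpick0 => nz; have := memv_pick (Kh D i j); set v := vpick _ in nz *.
move/(subvP (diffvSl _ _)); rewrite memv_cap => /andP[/chainsP vX _].
have /existsP[x nzx] : [exists x, v x != 0].
  apply: contraR nz => /existsPn v0; apply/eqP/ffunP => x; rewrite ffunE.
  exact/eqP/negPn.
by exists x; have /andP[/eqP ? /eqP ?] := vX x nzx.
Qed.

Hypothesis alt : alternating D.
Hypothesis no_circles : circles D = 0%N.

Lemma diff_degrees x y : diff_coef x y != 0 ->
  hom_degree y = hom_degree x + 1 /\ quantum_degree y = quantum_degree x.
Proof.
move=> nz; have hE : hom_degree y = hom_degree x + 1.
  have [c [cx yE _]] := diff_coef_neq0 nz.
  by rewrite /hom_degree yE cardsU1 cx; move: #|_| (n_neg D); clear=> n1 n2; lia.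
rewrite !quantum_degreeE (diff_homogeneous alt no_circles nz) hE; split=> //.
by move: (diagonal x) (hom_degree x) (n_pos D); clear=> n1 n2 n3; lia.
Qed.

Lemma Kh_exact i j :
  exact_at (@diff_coef D) (@diagonal D) setT (j - 2 * i - (n_pos D)%:Z) ->
  Kh D i j = 0%VS.
Proof.
move=> ex; apply/eqP; rewrite diffv_eq0; apply/subvP => f; rewrite memv_cap.
case/andP => /chainsP fX; rewrite memv_ker lfunE => /eqP/ffunP df0.
have [x nz|y _|h _ hE] := ex f.
- rewrite inE; have /andP[/eqP <- /eqP <-] := fX x nz.
  by rewrite quantum_degreeE; apply/eqP; move: (n_pos D); clear=> n; lia.
- by have := df0 y; rewrite !ffunE; apply: etrans; apply: eq_bigl => x; rewrite inE.
(* Exactness controls only the diagonal. As the differential respects both degrees, truncating [h]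
   to one bidegree does not change its boundary in bidegree (i, j). *)
pose h' : chain D := [ffun x => if (hom_degree x == i - 1) && (quantum_degree x == j)
  then h x else 0].
have h'X : h' \in chains D (i - 1) j.
  by apply/chainsP => x; rewrite ffunE; case: ifP => //; rewrite eqxx.
suff -> : f = linfun (@differential D) h' by apply: memv_img.
rewrite lfunE; apply/ffunP => y; rewrite ffunE.
have degE x : diff_coef x y != 0 ->
    (hom_degree x == i - 1) && (quantum_degree x == j) =
    (hom_degree y == i) && (quantum_degree y == j).
  by case/diff_degrees => -> ->; rewrite eq_sym subr_eq eq_sym.
have [ydeg|ydeg] := boolP ((hom_degree y == i) && (quantum_degree y == j)); last first.
  have -> : f y = 0 by apply/eqP; apply: contraNT ydeg => /fX.
  rewrite big1 // => x _; have [->|nz] := eqVneq (diff_coef x y) 0; first exact: mulr0.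
  by rewrite ffunE degE // (negPf ydeg) mul0r.
rewrite -hE ?inE //; apply: eq_big => x; rewrite inE // => _.
have [->|nz] := eqVneq (diff_coef x y) 0; first by rewrite !mulr0.
by rewrite ffunE degE // ydeg.
Qed.

End Homology.

(** * Signatures *)

Section Laplacian.

Variables (m : nat) (a : 'I_m.+1 -> 'I_m.+1 -> nat) (eta : int).
Hypotheses (eta1 : eta = 1 \/ eta = -1) (a_sym : forall i j, a i j = a j i).
Hypothesis a_conn : forall v : 'I_m.+1 -> algC,
  (forall i j, a i j != 0%N -> v i = v j) -> forall i, v i = v ord0.

Variable A : 'M[int]_m.
Hypothesis AE : forall i j, A i j = eta *
  (if i == j then \sum_(k | k != lift ord0 i) (a (lift ord0 i) k)%:Z
   else - (a (lift ord0 i) (lift ord0 j))%:Z).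

Lemma size_eigenvalues : size (eigenvalues (map_mx intr A)) = m.
Proof.
rewrite /eigenvalues; case: closed_field_poly_normal => s /= cpE.
have := size_char_poly (map_mx intr A : 'M[algC]_m).
by rewrite cpE (monicP (char_poly_monic _)) scale1r size_prod_XsubC => -[].
Qed.

Lemma mem_eigenvalues z : z \in eigenvalues (map_mx intr A) ->
  root (char_poly (map_mx intr A)) z.
Proof.
rewrite /eigenvalues; case: closed_field_poly_normal => s /= {1}-> zs.
by rewrite (monicP (char_poly_monic _)) scale1r root_prod_XsubC.
Qed.

(** Extending an eigenvector by 0 at the deleted vertex to w gives 2 z sum |w_j|^2 = eta sum a_ij
    |w_j - w_i|^2. The last sum is positive, for otherwise connectivity would make w constant, hence
    zero. *)
Lemma laplacian_eigenvalue (z : algC) : root (char_poly (map_mx intr A)) z -> 0 < eta%:~R * z.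
Proof.
rewrite -eigenvalue_root_char => /eigenvalueP[v vA nzv].
pose w (i : 'I_m.+1) : algC := if unlift ord0 i is Some j then v 0 j else 0.
have w0 : w ord0 = 0 by rewrite /w unlift_none.
have wl j : w (lift ord0 j) = v 0 j by rewrite /w liftK.
(* The factor conjugate to [w j] makes this hold at the deleted vertex too. *)
have eigE j : z * w j * (w j)^* = eta%:~R * \sum_i (a i j)%:R * (w j - w i) * (w j)^*.
  case: (unliftP ord0 j) => [k ->|->]; last first.
    rewrite w0 conjC0 mulr0 big1 ?mulr0 // => i _.
    by rewrite mulr0.
  rewrite -mulr_suml mulrA; congr (_ * _); rewrite wl.
  have := congr1 (fun u : 'rV_m => u 0 k) vA; rewrite !mxE => <-.
  under eq_bigr do rewrite mxE AE rmorphM mulrCA.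
  rewrite -mulr_sumr; congr (_ * _).
  rewrite (bigD1 k) //= eqxx rmorph_sum /= mulr_sumr.
  rewrite [in RHS](bigD1 (lift ord0 k)) //= wl subrr mulr0 add0r.
  under [in RHS]eq_bigr do rewrite mulrBr.
  rewrite sumrB; congr (_ + _).
    by apply: eq_bigr => i _; rewrite a_sym mulrC.
  rewrite [in RHS]big_mkcond big_ord_recl /= w0 mulr0 add0r -sumrN.
  rewrite [LHS]big_mkcond; apply: eq_bigr => i _.
  rewrite (inj_eq lift_inj); case: eqP => [->|_] /=; first by rewrite oppr0.
  by rewrite rmorphN mulrN wl mulrC.
pose P := \sum_j `|w j| ^+ 2; pose Q := \sum_j \sum_i (a i j)%:R * `|w j - w i| ^+ 2.
have PQ : 2 * (z * P) = eta%:~R * Q.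
  have zP : z * P = eta%:~R * \sum_j \sum_i (a i j)%:R * (w j - w i) * (w j)^*.
    rewrite [in RHS]mulr_sumr mulr_sumr; apply: eq_bigr => j _.
    by rewrite normCK mulrA eigE.
  rewrite mulr2n mulrDl mul1r {1}zP [in X in _ + X]zP -mulrDr; congr (_ * _).
  rewrite [X in X + _]exchange_big -big_split; apply: eq_bigr => j _ /=.
  rewrite -big_split; apply: eq_bigr => i _ /=.
  rewrite a_sym -!mulrA -mulrDr normCK rmorphB /=; congr (_ * _).
  by rewrite -[w i - w j]opprB mulNr addrC mulrBr.
have P_gt0 : 0 < P.
  have [j nzj] : exists j, v 0 j != 0.
    by apply/existsP; apply: contraNT nzv => /existsPn v0; apply/eqP/rowP => j; rewrite mxE; apply/eqP/negPn.
  rewrite /P (bigD1 (lift ord0 j)) //= wl ltr_pwDl ?exprn_gt0 ?normr_gt0 //.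
  by apply: sumr_ge0 => i _; rewrite exprn_ge0.
have Q_ge0 : 0 <= Q.
  by do 2!apply: sumr_ge0 => ? _; rewrite mulr_ge0 ?ler0n ?exprn_ge0.
have Q_gt0 : 0 < Q.
  rewrite lt_neqAle Q_ge0 andbT eq_sym; apply/eqP => Q0.
  have w_const i : w i = w ord0.
    apply: a_conn => {}i j aij; apply/eqP; rewrite -subr_eq0 -normr_eq0 -sqrf_eq0.
    move/eqP: Q0; rewrite psumr_eq0 => [/allP /(_ i)|k _]; last first.
      by apply: sumr_ge0 => ? _; rewrite mulr_ge0 ?ler0n ?exprn_ge0.
    rewrite mem_index_enum => /(_ isT) /=; rewrite psumr_eq0 => [/allP /(_ j)|k _]; last first.
      by rewrite mulr_ge0 ?ler0n ?exprn_ge0.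
    by rewrite mem_index_enum => /(_ isT) /=; rewrite mulf_eq0 pnatr_eq0 a_sym (negPf aij).
  by case/eqP: (lt0r_neq0 P_gt0); apply: big1 => i _; rewrite w_const w0 normr0 expr0n.
have etaK : eta%:~R * eta%:~R = 1 :> algC.
  by case: eta1 => ->; rewrite ?mulr1 // rmorphN mulrNN mulr1.
have : 0 < 2 * (eta%:~R * z) * P.
  by rewrite -mulrA -[eta%:~R * z * P]mulrA mulrCA PQ mulrA etaK mul1r.
by rewrite pmulr_lgt0 // pmulr_rgt0 // ltr0n.
Qed.

Lemma sig_laplacian : sig A = eta * m%:Z.
Proof.
rewrite /sig; set s := eigenvalues _.
have signs (z : algC) : z \in s -> 0 < eta%:~R * z.
  by move/mem_eigenvalues/laplacian_eigenvalue.
have sm : size s = m by apply: size_eigenvalues.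
case: eta1 signs => -> signs.
  have -> : count (fun z => 0 < z) s = m.
    rewrite -sm; apply/eqP; rewrite -all_count; apply/allP => z /signs.
    by rewrite mul1r.
  rewrite (@eq_in_count _ _ pred0) ?count_pred0 ?subr0 ?mul1r // => z /signs /=.
  by rewrite mul1r; apply: lt_gtF.
have -> : count (fun z => z < 0) s = m.
  rewrite -sm; apply/eqP; rewrite -all_count; apply/allP => z /signs.
  by rewrite rmorphN mulN1r oppr_gt0.
rewrite (@eq_in_count _ _ pred0) ?count_pred0 ?sub0r ?mulN1r // => z /signs /=.
by rewrite rmorphN mulN1r oppr_gt0; apply: lt_gtF.
Qed.

End Laplacian.

Lemma card_imset_le (T U V : finType) (f : T -> U) (g : T -> V) :
  (forall t u, f t = f u -> g t = g u) -> (#|g @: T| <= #|f @: T|)%N.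
Proof.
move=> fg; pose h y := omap g [pick t | f t == y].
have Some_inj : injective (@Some V) by move=> x y [].
rewrite -(card_imset _ Some_inj); apply: leq_trans (leq_imset_card h _).
apply/subset_leq_card/subsetP => _ /imsetP[_ /imsetP[t _ ->] ->].
apply/imsetP; exists (f t); first exact: imset_f.
by rewrite /h; case: pickP => [u /eqP/fg <-|/(_ t)] //; rewrite eqxx.
Qed.

Lemma eq_card_imset (T U V : finType) (f : T -> U) (g : T -> V) :
  (forall t u, (f t == f u) = (g t == g u)) -> #|f @: T| = #|g @: T|.
Proof.
move=> fg; apply/eqP; rewrite eqn_leq; apply/andP; split; apply: card_imset_le => t u /eqP.
  by rewrite -fg => /eqP.
by rewrite fg => /eqP.
Qed.

Lemma fconnect_porbit (T U : finType) (f : U -> U) (w : T -> U) (s : {perm T}) t u :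
    injective w -> (forall v, f (w v) = w (s v)) ->
  fconnect f (w t) (w u) = (porbit s t == porbit s u).
Proof.
move=> w_inj fw; have iterE n : iter n f (w t) = w ((s ^+ n)%g t).
  by elim: n => [|n IHn]; rewrite ?expg0 ?perm1 //= IHn fw expgSr permM.
rewrite eq_sym eq_porbit_mem; apply/idP/porbitP => [/iter_findex|[n ->]].
  by rewrite iterE => /w_inj <-; exists (findex f (w t) (w u)).
by rewrite -iterE fconnect_iter.
Qed.

(** * Regions and checkerboard colorings *)

Section Regions.

Variable D : diagram.
Local Notation C := (crossing D).
Implicit Types (d e : dart D) (c : C).

Lemma corner_inj : injective (arc \o rot : dart D -> dart D).
Proof. by move=> d e /(can_inj (@arcK D)) de; rewrite -[d]rot4 de rot4. Qed.

Lemma region_at_eq d e : (region_at d == region_at e) = fconnect (arc \o rot) d e.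
Proof.
have sym := fconnect_sym corner_inj.
apply/eqP/idP => [[/setP /(_ e)]|de]; first by rewrite !inE connect0.
by congr inl; apply/setP => v; rewrite !inE (same_connect sym de).
Qed.

Lemma region_at_arc d : region_at (arc (rot d)) = region_at d.
Proof. by apply/esym/eqP; rewrite region_at_eq fconnect1. Qed.

Lemma region_at_regions d : region_at d \in regions D.
Proof. by rewrite inE imset_f. Qed.

Lemma card_regions :
  #|regions D| = (#|components (frel (arc \o rot : dart D -> dart D))| + 2 * circles D)%N.
Proof.
rewrite /regions cardsU (_ : _ :&: _ = set0) ?cards0 ?subn0; last first.
  apply/setP => r; rewrite !inE; apply/negbTE/andP => -[/imsetP[d _ ->]].
  by case/imsetP.
congr (_ + _)%N.
  have inl_inj : injective (@inl {set dart D} ('I_(circles D) * bool)%type) by move=> A B [].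
  by rewrite -(card_imset (components _) inl_inj) /components -imset_comp.
rewrite card_imset; last by move=> k l [].
by rewrite card_prod card_ord card_bool mulnC.
Qed.

Section Coloring.

Variables (xi : coloring D) (m : nat) (X : 'I_m.+1 -> region D).
Hypothesis Xwhite : white_enum xi X.

Lemma card_white : #|[set r in regions D | ~~ xi r]| = m.+1.
Proof.
case: Xwhite => Xinj XE; rewrite -[RHS]card_ord -(card_codom Xinj).
by apply: eq_card => r; rewrite inE XE.
Qed.

Lemma white_region d : ~~ xi (region_at d) -> exists i, X i = region_at d.
Proof.
move=> wd; have : region_at d \in codom X.
  by case: Xwhite => _ ->; rewrite region_at_regions.
by case/codomP => i ->; exists i.
Qed.

End Coloring.

Lemma card_white_black (xi : coloring D) m (X : 'I_m.+1 -> region D)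
    m' (X' : 'I_m'.+1 -> region D) :
  white_enum xi X -> white_enum (dual_coloring xi) X' ->
  #|regions D| = (m.+1 + m'.+1)%N.
Proof.
move=> /card_white <- /card_white <-; rewrite -(cardsID [set r | xi r]) addnC.
by congr (_ + _)%N; apply: eq_card => r; rewrite !inE ?negbK // andbC.
Qed.

Lemma coloring_rot (xi : coloring D) d : checkerboard xi ->
  xi (region_at (rot d)) = ~~ xi (region_at d).
Proof. by case=> /(_ d); case: (xi _) (xi _) => [] []. Qed.

(** Some over-corner is white; opposite corners have equal colors and neighboring ones different
    colors. *)
Lemma coloring_incidence (xi : coloring D) c b o : checkerboard xi ->
  incidence xi c = -1 -> xi (region_at (c, b, o)) = ~~ b.
Proof.
move=> ck; have rr d : xi (region_at (rot (rot d))) = xi (region_at d).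
  by rewrite !coloring_rot // negbK.
rewrite /incidence; case: ifP => // /forallPn[o' /negPf wo'] _.
have over_white o1 : xi (region_at (c, true, o1)) = false.
  case: (eqVneq o1 o') => [-> //|]; rewrite -wo' -(rr (c, true, o1)) rot2.
  by case: o1 o' {wo'} => [] [].
case: b => //=; have := coloring_rot (c, true, o (+) (true (+) positive c)) ck.
rewrite over_white /= => <-; congr (xi (region_at (_, _, _))).
by case: o (positive c) => [] [].
Qed.

End Regions.

(** * Extreme states and Goeritz matrices of a connected diagram *)

Section Connected.

Variable D : diagram.
Hypotheses (alt : alternating D) (no_circles : circles D = 0%N) (connD : connected D).
Local Notation C := (crossing D).
Local Notation T := (C * bool)%type.
Local Notation S a := (porbit (cycle_perm alt a)).

Lemma dart_components : #|components [rel x y : dart D | (y == rot x) || (y == arc x)]| = 1%N.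
Proof. by move: connD; rewrite /connected /num_components no_circles addn0. Qed.

Lemma strand_inhabited : inhabited T.
Proof.
have /eqP/cards1P[A] := dart_components => AE.
have : A \in [set A] by rewrite inE.
by rewrite -AE => /imsetP[d _ _]; constructor; apply: (foot d).
Qed.

(** Each arc has one end on an over-strand and one on an under-strand, so comparing from one kind of
    end is enough. *)
Lemma crossing_connected (U : Type) (k : C -> U) b :
  (forall d : dart D, d.1.2 = b -> k (arc d).1.1 = k d.1.1) -> forall c c', k c = k c'.
Proof.
move=> karc c c'; have /eqP/cards1P[A] := dart_components => AE.
have classE d : [set y | connect [rel x y : dart D | (y == rot x) || (y == arc x)] d y] = A.
  by apply/set1P; rewrite -AE; apply: imset_f.
have : (c', true, true) \in A by rewrite -(classE (c', true, true)) inE connect0.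
rewrite -(classE (c, true, true)) inE => /(class_invariant (k := fun d => k d.1.1)).
apply=> v w /= /orP[] /eqP->; first by rewrite rot_strand.
have [/karc-> //|nb] := eqVneq (v.1.2) b.
rewrite -[in LHS](arcK v) karc // arc_strand //.
by case: (v.1.2) b nb {karc} => [] [].
Qed.

Lemma cl_connected t u :
  class (linked alt set0 setT) t = class (linked alt set0 setT) u.
Proof.
rewrite (surjective_pairing t) (surjective_pairing u).
rewrite !(cl_crossing alt _ _ true) ?inE //.
pose k c := class (linked alt set0 setT) (c, true); rewrite -!/(k _).
apply: (crossing_connected (b := false)) => d db.
set v := foot (mate set0 d).
have vE : over v = mate set0 d by rewrite over_foot // mate_strand db.
have arcE : over (step set0 v) = arc d by rewrite over_step // vE mateK.
have -> : (arc d).1.1 = (step set0 v).1 by rewrite -arcE.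
have -> : d.1.1 = v.1 by rewrite -[v.1]/((over v).1.1) vE mate_strand.
have kE w : k w.1 = class (linked alt set0 setT) w.
  by rewrite /k [w in RHS]surjective_pairing; apply: cl_crossing; rewrite inE.
rewrite !kE; apply: cl_smoothing; rewrite -(porbit_app (cycle_perm alt set0) v).
by rewrite permE.
Qed.

Lemma card_cycles a : #|cycles a| = #|S a @: {: T}|.
Proof.
rewrite -(eq_card_imset (f := cyc alt a)) => [|t u]; last exact: cyc_eq.
apply: eq_card => k; apply/(cyclesP alt no_circles)/imsetP => [[t ->]|[t _ ->]]; by exists t.
Qed.

(** When all crossings are 1-smoothed, following a cycle is the same as walking around the region at
    an over-corner. *)
Lemma card_regions_over :
  #|[set region_at (over t) | t : T]| = #|cycles (setT : state D)|.
Proof.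
rewrite card_cycles; apply: eq_card_imset => t u; rewrite region_at_eq.
apply: fconnect_porbit => [|v]; first exact: (can_inj (@overK D)).
by rewrite permE over_step //= mate_over inE.
Qed.

(** When all crossings are 0-smoothed, walking around the region at an under-corner follows a cycle
    backwards, whence [porbitV]. *)
Lemma card_regions_under :
  #|[set region_at (mate set0 (over t)) | t : T]| = #|cycles (set0 : state D)|.
Proof.
rewrite card_cycles; apply: eq_card_imset => t u; rewrite region_at_eq.
rewrite -(porbitV (cycle_perm alt set0) t) -(porbitV (cycle_perm alt set0) u).
apply: (fconnect_porbit (w := fun t => mate set0 (over t))) => [|v]; first exact: inj_comp (can_inj (@mateK D set0)) (can_inj (@overK D)).
set v' := fun_of_perm (_^-1)%g v; have vE : v = step set0 v' by rewrite -[LHS](permKV (cycle_perm alt set0)) [LHS]permE.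
have <- : arc (over v) = mate set0 (over v') by rewrite vE over_step // arcK.
congr arc; rewrite mate_over inE rot2 /= negbK.
by case: (v).
Qed.

Section Signature.

Variables (xi : coloring D) (b : bool) (eta : int) (m : nat) (X : 'I_m.+1 -> region D).
Hypotheses (eta1 : eta = 1 \/ eta = -1) (incE : forall c, incidence xi c = eta).
Hypothesis colorE : forall c b' o, xi (region_at (c, b', o)) = (b' != b).
Hypothesis Xwhite : white_enum xi X.

Lemma white_regions : [set r in regions D | ~~ xi r] = [set region_at (p.1, b, p.2) | p : T].
Proof.
apply/setP => r; apply/idP/imsetP => [|[[c o] _ ->]]; last first.
  by rewrite inE region_at_regions colorE eqxx.
rewrite inE => /andP[]; rewrite inE => /orP[/imsetP[[[c b'] o] _ ->]|]; last first.
  by case/imsetP => -[i b'] _ _; have := ltn_ord i; rewrite {2}no_circles.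
by rewrite colorE negbK => /eqP->; exists (c, o).
Qed.

(** The matrix is eta times a reduced Laplacian, with white regions as vertices and weights counting
    common crossings. The graph is connected: the white regions at a crossing are adjacent, and the
    ends of an arc share the white region beside it. *)
Lemma sig_goeritz : sig (goeritz xi X) = eta * m%:Z.
Proof.
pose a i j := #|[set c | adjacent c (X i) && adjacent c (X j)]|.
have offE i j : goeritz_off xi (X i) (X j) = - (eta * (a i j)%:Z).
  rewrite /goeritz_off (eq_bigr (fun=> eta)) => [|c _]; last exact: incE.
  rewrite sumr_const -mulr_natr natz; congr (- (_ * _%:Z)).
  by apply: eq_card => c; rewrite inE.
apply: (sig_laplacian (a := a) eta1) => [i j|v v_adj i|i j].
- by apply: eq_card => c; rewrite !inE andbC.
- have white_at c o : exists i, X i = region_at (c, b, o).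
    by apply: (white_region Xwhite); rewrite colorE eqxx.
  pose idx d := odflt ord0 [pick i | X i == region_at d].
  have idxE c o : X (idx (c, b, o)) = region_at (c, b, o).
    rewrite /idx; case: pickP => [j /eqP //|none].
    by have [j jE] := white_at c o; have := none j; rewrite jE eqxx.
  have sameX c r s : adjacent c (X r) -> adjacent c (X s) -> v r = v s.
    move=> cr cs; apply: v_adj; rewrite -lt0n; apply/card_gt0P; exists c.
    by rewrite inE cr cs.
  have adj c o : adjacent c (X (idx (c, b, o))).
    by apply/existsP; exists (b, o); rewrite idxE.
  have [_ XE] := Xwhite; have Xinj := Xwhite.1.
  have idxP c o j : X j = region_at (c, b, o) -> j = idx (c, b, o).
    by rewrite -idxE => /Xinj.
  pose k c := v (idx (c, b, true)).
  have kE c o : v (idx (c, b, o)) = k c by apply: (sameX c).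
  have k_const c c' : k c = k c'.
    apply: (crossing_connected (b := ~~ b)) => d db.
    (* The white region along the arc of [d] also has a corner at the crossing of [d]. *)
    have [o oE] : exists o, region_at (arc d) = region_at (d.1.1, b, o).
      exists (rot (rot (rot d))).2; rewrite -[in LHS](rot4 d) region_at_arc.
      congr region_at; rewrite [LHS]surjective_pairing rot_strand rot2 /=.
      by rewrite db negbK.
    have arcE : arc d = ((arc d).1.1, b, (arc d).2).
      rewrite {1}[arc d]surjective_pairing [(arc d).1]surjective_pairing.
      by rewrite arc_strand // db negbK.
    rewrite -(kE _ (arc d).2) -(kE _ o); congr v; apply: idxP.
    by rewrite idxE -arcE.
  have vk j : exists c, v j = k c.
    have : X j \in [set r in regions D | ~~ xi r] by rewrite inE -XE codom_f.
    by rewrite white_regions => /imsetP[[c o] _ /idxP ->]; exists c; apply: kE.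
  by have [c ->] := vk i; have [c' ->] := vk ord0.
rewrite mxE /goeritz_entry (inj_eq lift_inj); case: eqP => [->|_]; last by rewrite offE mulrN.
by rewrite mulr_sumr -sumrN; apply: eq_bigr => k _; rewrite offE opprK.
Qed.

End Signature.

End Connected.

(** * The support *)

Section Support.

Variable D : diagram.

Lemma incidence_dual (xi : coloring D) c : checkerboard xi ->
  incidence xi c = -1 -> incidence (dual_coloring xi) c = 1.
Proof.
move=> ck inc; rewrite /incidence; case: ifP => // /forallPn[o].
by rewrite /dual_coloring (coloring_incidence _ _ ck inc).
Qed.

Lemma correction_neg (xi : coloring D) :
  (forall c, incidence xi c = -1) -> correction xi = - (n_neg D)%:Z.
Proof.
move=> inc; rewrite /correction (eq_big [in [set c | ~~ positive c]] (fun=> -1)) => [|c|c _] //.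
  by rewrite sumr_const mulNrn natz.
by rewrite inE /typeII inc /writhe; case: (positive c).
Qed.

Lemma correction_pos (xi : coloring D) :
  (forall c, incidence xi c = 1) -> correction xi = (n_pos D)%:Z.
Proof.
move=> inc; rewrite /correction (eq_big [in [set c | positive c]] (fun=> 1)) => [|c|c _] //.
  by rewrite sumr_const natz.
by rewrite inE /typeII inc /writhe; case: (positive c).
Qed.

Lemma card_crossings : #|crossing D| = (n_pos D + n_neg D)%N.
Proof.
rewrite /n_pos /n_neg -cardsT -(cardsID [set c | positive c]) setTI.
by congr (_ + _)%N; apply: eq_card => c; rewrite !inE andbT.
Qed.

Variables (g : nat) (xi : coloring D) (m : nat) (X : 'I_m.+1 -> region D)
  (m' : nat) (X' : 'I_m'.+1 -> region D).
Hypotheses (connD : connected D) (alt : alternating D) (genusD : has_genus D g).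
Hypotheses (ck : checkerboard xi) (inc : forall c, incidence xi c = -1).
Hypotheses (Xwhite : white_enum xi X) (Xblack : white_enum (dual_coloring xi) X').

Lemma euler : (n_pos D + n_neg D = m + m' + 2 * g)%N.
Proof.
move: genusD; rewrite /has_genus /euler_char.
have := card_white_black Xwhite Xblack; rewrite card_regions card_crossings.
move: #|components _| (circles D) (n_pos D) (n_neg D); clear=> n1 n2 n3 n4; lia.
Qed.

(** A connected diagram with a crossingless component is one circle on a sphere, with one region of
    each color and empty Goeritz matrices. *)
Lemma circle_case : circles D != 0%N ->
  [/\ forall d : dart D, False, circles D = 1%N, m = 0%N & m' = 0%N].
Proof.
move=> nz; move: connD; rewrite /connected /num_components.
set E := components _ => conn.
have c1 : circles D = 1%N by move: nz conn; move: #|E| (circles D); clear=> n1 n2; lia.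
have noD (d : dart D) : False.
  have : E = set0 by apply/eqP; rewrite -cards_eq0; move: conn; rewrite c1 addn1 => -[->].
  by move/setP => /(_ [set y | connect [rel x y : dart D | (y == rot x) || (y == arc x)] d y]);
    rewrite imset_f ?inE.
have := card_white_black Xwhite Xblack; rewrite card_regions c1.
rewrite [components _](_ : _ = set0) ?cards0; last first.
  by apply/setP => A; rewrite inE; apply/imsetP => -[d].
by clear -c1 noD; case: m m' => [|n] [|n'] //; rewrite ?addSn ?addnS.
Qed.

Lemma signature_xi : signature xi X = (n_neg D)%:Z - m%:Z.
Proof.
rewrite /signature correction_neg // opprK addrC; congr (_ + _).
have [c0|/circle_case[_ _ m0 _]] := eqVneq (circles D) 0%N; last first.
  have -> : sig (goeritz xi X) = -1 * m%:Z; last by rewrite mulN1r.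
  move: X; rewrite m0 => Y; rewrite /sig.
  have := size_eigenvalues (goeritz xi Y).
  by case: (eigenvalues _).
rewrite (sig_goeritz (b := true) (eta := -1) alt c0 connD) ?mulN1r //; first by right.
by move=> c b o; rewrite (coloring_incidence _ _ ck (inc c)); case: b.
Qed.

Lemma signature_dual : signature (dual_coloring xi) X' = m'%:Z - (n_pos D)%:Z.
Proof.
have inc' c := incidence_dual ck (inc c).
rewrite /signature correction_pos //; congr (_ - _).
have [c0|/circle_case[_ _ _ m0]] := eqVneq (circles D) 0%N; last first.
  move: X'; rewrite m0 => Y; rewrite /sig.
  have := size_eigenvalues (goeritz (dual_coloring xi) Y).
  by case: (eigenvalues _).
rewrite (sig_goeritz (b := false) (eta := 1) alt c0 connD) ?mul1r //; first by left.
move=> c b o; rewrite /dual_coloring (coloring_incidence _ _ ck (inc c)).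
by case: b.
Qed.

Lemma support i j : Kh D i j != 0%VS ->
  exists2 k : nat, (k < g.+2)%N & j - 2 * i = 1 - m'%:Z + (n_pos D)%:Z - 2 * k%:Z.
Proof.
move=> nz; have [x [xi_ xj]] := Kh_gen nz.
have jE : j - 2 * i = diagonal x + (n_pos D)%:Z.
  by rewrite -xi_ -xj quantum_degreeE; move: (diagonal x) (hom_degree x) (n_pos D); clear=> a b n; lia.
have [c0|/circle_case[noD c1 m0 m0']] := eqVneq (circles D) 0%N; last first.
  have noC (c : crossing D) : False := noD (c, true, true).
  have s0 (A : {set crossing D}) : #|A| = 0%N.
    by apply/eqP; rewrite cards_eq0; apply/eqP/setP => c; case: (noC c).
  have k1 : #|cycles (gen_state x)| = 1%N.
    rewrite /cycles [components _](_ : _ = set0); last first.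
      by apply/setP => A; rewrite inE; apply/imsetP => -[d].
    by rewrite imset0 set0U card_imset ?card_ord // => k l [].
  have := subset_leq_card (valP x : gen_X x \subset cycles (gen_state x)).
  rewrite k1 jE /diagonal k1 s0 m0' /n_pos s0 => le1.
  (* For the single circle, k is 0 for the label 1 and 1 for the label X. *)
  exists #|gen_X x|; first exact: leq_ltn_trans le1 _.
  by move: #|gen_X x|; clear=> n; lia.
have W : m.+1 = #|cycles (setT : state D)|.
  rewrite -(card_white Xwhite) -(card_regions_over alt c0).
  have colorE c b o : xi (region_at (c, b, o)) = (b != true).
    by rewrite (coloring_incidence _ _ ck (inc c)); case: b.
  by rewrite (white_regions c0 colorE).
have B : m'.+1 = #|cycles (set0 : state D)|.
  rewrite -(card_white Xblack) -(card_regions_under alt c0).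
  have colorE c b o : dual_coloring xi (region_at (c, b, o)) = (b != false).
    by rewrite /dual_coloring (coloring_incidence _ _ ck (inc c)); case: b.
  rewrite (white_regions c0 colorE).
  apply: eq_card => r; apply/imsetP/imsetP => [[[c o] _ ->]|[t _ ->]].
    exists (foot (mate set0 (c, false, o))) => //.
    by rewrite over_foot // mate_strand mateK.
  set d := mate _ _; exists (d.1.1, d.2) => //; congr region_at.
  by rewrite [LHS]surjective_pairing mate_strand /= [LHS]surjective_pairing.
have [k0 kE] := odd_diagonal alt c0 x.
have [t0] := strand_inhabited c0 connD.
have bound : (diagonal x <= 2 - m'.+1%:Z) && (m.+1%:Z - #|crossing D|%:Z - 2 <= diagonal x).
  apply: contraNT nz; rewrite negb_and -!ltNge => out; apply/eqP.
  apply: (Kh_exact alt c0); rewrite jE addrK.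
  apply: (exact_total c0 (cl_connected alt c0 connD) t0).
  by rewrite -W -B.
rewrite kE -B card_crossings euler in bound; rewrite jE kE -B.
(* Solving m' + 1 - 2 k0 = 1 - m' - 2 k gives k = k0 - m'; [bound] says that it lies between 0 and g
   + 1. *)
exists `|(k0 + 1 - m'.+1%:Z)%R|%N; move: bound (n_pos D); clear=> bound n; lia.
Qed.

End Support.

Theorem theorem5p1 (D : virtual_diagram) (g : nat)
    (xi : coloring (surface_diagram D))
    (m : nat) (X : 'I_m.+1 -> region (surface_diagram D))
    (m' : nat) (X' : 'I_m'.+1 -> region (surface_diagram D)) :
  connected (surface_diagram D) ->
  alternating (surface_diagram D) ->
  has_genus (surface_diagram D) g ->
  checkerboard xi ->
  (forall c, incidence xi c = -1) ->
  white_enum xi X ->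
  white_enum (dual_coloring xi) X' ->
  let sigma := signature xi X in
  let sigma' := signature (dual_coloring xi) X' in
  (* the last of the g + 2 lines *)
  - sigma' + 1 - 2 * (g.+1)%:Z = - sigma - 1 /\
  forall i j : int, Kh (surface_diagram D) i j != 0%VS ->
    exists2 k : nat, (k < g.+2)%N & j - 2 * i = - sigma' + 1 - 2 * k%:Z.
Proof.
move=> conn alt genus ck inc white black sigma sigma'.
have eE := euler genus white black.
rewrite /sigma /sigma' (signature_xi conn alt ck inc white black).
rewrite (signature_dual conn alt ck inc white black).
split; first by move: eE; move: (n_pos _) (n_neg _); clear=> n1 n2; lia.
move=> i j /(support conn alt genus ck inc white black)[k ltk ->].
by exists k => //; move: (n_pos _); clear=> n; lia.
Qed.
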